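(* Let $(P,g,\Phi)$ be a Carrollian $\mathbb{R}^\times$-bundle with a connection over an oriented $n$-dimensional manifold $M$, with $g$ of signature $(1,\ldots,1,0)$ and with Euler vector field $\Delta_P$ Killing for $g$, i.e. $\mathcal{L}_{\Delta_P}g=0$. Let $\Delta_{HdR}:=d\circ\delta+\delta\circ d:\Omega^k(P)\to\Omega^k(P)$ be the associated Hodge--de Rham Laplacian. If $\xi\in\Omega^k(P)$ is homogeneous of weight $\lambda\in\mathbb{R}$, i.e. $\mathcal{L}_{\Delta_P}\xi=\lambda\,\xi$, then $\Delta_{HdR}\xi\in\Omega^k(P)$ is also homogeneous of weight $\lambda$, i.e. $\mathcal{L}_{\Delta_P}(\Delta_{HdR}\xi)=\lambda\,\Delta_{HdR}\xi$.
   Context: $\mathbb{R}^\times=\mathbb{R}\setminus\{0\}$ is the multiplicative group. Let $\pi:P\to M$ be a smooth principal $\mathbb{R}^\times$-bundle with $\dim M=n$, so $\dim P=n+1$. The Euler vector field $\Delta_P$ is the fundamental vector field of the action, i.e. the generator of $p\mapsto e^{s}\cdot p$, $s\in\mathbb{R}$; in local coordinates $(x^a,t)$ adapted to a trivialisation, $\Delta_P=t\,\partial_t$. It spans the sections of the vertical bundle $VP=\ker(d\pi)$. A Carrollian $\mathbb{R}^\times$-bundle is such a $P$ equipped with a degenerate metric $g$ (a smooth symmetric covariant 2-tensor) such that $\ker(g):=\{X\in\mathrm{Vect}(P) : g(X,-)=0\}$ equals the module of sections of $VP$. Here $g$ has signature $(1,\ldots,1,0)$, i.e. it is positive semi-definite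 of rank $n$. The connection $\Phi$ is a principal $\mathbb{R}^\times$-connection, with connection one-form $\theta\in\Omega^1(P)$: a globally defined real-valued $\mathbb{R}^\times$-invariant one-form with $\theta(\Delta_P)=1$ (so $\mathcal{L}_{\Delta_P}\theta=0$); locally $\theta=t^{-1}dt+A_a(x)\,dx^a$. The tensor $G:=g-\theta\otimes\theta$ is a non-degenerate Lorentzian metric on $P$ of signature $(1,\ldots,1,-1)$. $M$ is oriented, and $P$ is given the orientation in which $e^1\wedge\cdots\wedge e^n\wedge\theta$ is positive whenever $\{e^a\}$ is a local oriented coframe of forms annihilating $\Delta_P$ (oriented via $M$). $\mathsf{Vol}_P$ denotes the corresponding metric volume form of $G$; when $g=\pi^*g_M$ for a metric $g_M$ on $M$ with volume form $\mathsf{Vol}_M$, it is $\mathsf{Vol}_P=(-1)^n\theta\wedge\mathsf{Vol}_M$. The Hodge star of $\xi\in\Omega^k(P)$ is the unique $(n+1-k)$-form $\star\xi$ with $\eta\wedge\star\xi=\langle\eta,\xi\rangle_G\,\mathsf{Vol}_P$ for all $\eta\in\Omega^k(P)$, where $\langle\cdot,\cdot\rangle_G$ is the pointwise inner product on $k$-forms induced by $G$. $d$ is the de Rham differential on $P$, and the de Rham codifferential $\delta:\Omega^k(P)\to\Omega^{k-1}(P)$ is $\delta\xi:=(-1)^{1+k(n+1-k)}\star d\star\xi$. *)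

(* Defs.v *)
(** Smooth manifolds, covariant tensor calculus and Carrollian [R^x]-bundles,
    over the Mathematical Components Analysis library.

    A point of [R^m] and a tangent vector in coordinates is a row vector
    ['rV[R]_m]; the differential of a map [f] at [x] is [v |-> v *m 'J f x]; a
    [k]-tuple of vectors is a matrix ['M[R]_(k, m)] whose rows are its members. *)
From HB Require Import structures.
From mathcomp Require Import all_boot all_order all_algebra perm.
From mathcomp Require Import all_classical all_reals all_analysis.
Set Implicit Arguments.
Unset Strict Implicit.
Unset Printing Implicit Defensive.
Import Order.TTheory GRing.Theory Num.Theory.
Import numFieldNormedType.Exports.
Local Open Scope classical_set_scope.
Local Open Scope ring_scope.

(** ** Smooth maps on open sets of [R^m] *)

Fixpoint Ck_on (R : realType) (m : nat) (W : normedModType R) (r : nat)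
    (f : 'rV[R]_m -> W) (U : set 'rV[R]_m) : Prop :=
  match r with
  | 0 => forall x, U x -> {for x, continuous f}
  | r'.+1 => (forall x, U x -> differentiable f x) /\
             (forall v, Ck_on r' (fun x => 'D_v f x) U)
  end.

(** Used for open [U] only. *)
Definition smooth_on (R : realType) (m : nat) (W : normedModType R)
    (f : 'rV[R]_m -> W) (U : set 'rV[R]_m) : Prop :=
  forall r, Ck_on r f U.

(** ** Multilinear algebra on [R^m] *)

Definition set_row (R : realType) (k m : nat) (i : 'I_k) (w : 'rV[R]_m)
    (V : 'M[R]_(k, m)) : 'M[R]_(k, m) :=
  \matrix_(a < k, b < m) (if a == i then w 0 b else V a b).

Definition multilinear (R : realType) (k m : nat) (T : 'M[R]_(k, m) -> R) : Prop :=
  forall (i : 'I_k) (a : R) (u v : 'rV[R]_m) (V : 'M[R]_(k, m)),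
    T (set_row i (a *: u + v) V) = a * T (set_row i u V) + T (set_row i v V).

Definition alternating (R : realType) (k m : nat) (T : 'M[R]_(k, m) -> R) : Prop :=
  forall (V : 'M[R]_(k, m)) (i j : 'I_k), i != j -> row i V = row j V -> T V = 0.

(** [(k! l!)^-1 \sum_s sgn(s) a(v_{s 1}, ..., v_{s k}) b(v_{s (k+1)}, ..., v_{s (k+l)})] *)
Definition wedge (R : realType) (m k l : nat) (a : 'M[R]_(k, m) -> R)
    (b : 'M[R]_(l, m) -> R) (V : 'M[R]_(k + l, m)) : R :=
  ((k`! * l`!)%:R)^-1 *
  \sum_(s : 'S_(k + l)) (-1) ^+ s *
     (a (usubmx (row_perm s V)) * b (dsubmx (row_perm s V))).

(** The inner product on [k]-covectors in terms of the inverse [Ginv] of the Gram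
    matrix of the metric,
      [(k!)^-1 G^{i_1 j_1} ... G^{i_k j_k} a_{i_1 ... i_k} b_{j_1 ... j_k}],
    normalised so that
      [<a^1 /\ ... /\ a^k, b^1 /\ ... /\ b^k> = det <a^i, b^j>]. *)
Definition covector_inner (R : realType) (m k : nat) (Ginv : 'M[R]_m)
    (a b : 'M[R]_(k, m) -> R) : R :=
  (k`!%:R)^-1 *
  \sum_(i : {ffun 'I_k -> 'I_m}) \sum_(j : {ffun 'I_k -> 'I_m})
     (\prod_(r < k) Ginv (i r) (j r)) *
     (a (rowsub i 1%:M) * b (rowsub j 1%:M)).

(** When [k + l = m], [conform_mx 0 V] is [V] seen as a square matrix. *)
Definition is_hodge_covector (R : realType) (m k l : nat) (Ginv : 'M[R]_m)
    (vol : 'M[R]_m -> R) (xi : 'M[R]_(k, m) -> R) (zeta : 'M[R]_(l, m) -> R) : Prop :=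
  [/\ multilinear zeta, alternating zeta &
      forall eta : 'M[R]_(k, m) -> R, multilinear eta -> alternating eta ->
      forall V : 'M[R]_(k + l, m),
        wedge eta zeta V =
        covector_inner Ginv eta xi * vol (conform_mx (0 : 'M[R]_m) V)].

(** The target degree [l] is a parameter, to avoid casts; only [l = m - k] with
    [k <= m] is meaningful, and otherwise the result is zero. *)
Definition hodge_covector (R : realType) (m k l : nat) (Ginv : 'M[R]_m)
    (vol : 'M[R]_m -> R) (xi : 'M[R]_(k, m) -> R) : 'M[R]_(l, m) -> R :=
  if (k + l == m)%N
  then xget (fun _ => 0) [set zeta | is_hodge_covector Ginv vol xi zeta]
  else fun _ => 0.

(** ** Manifolds *)

(** Outside [dom c] and [coord c @` dom c] the values of [coord c] and [icoord c]
    are irrelevant. [chart_at] only records that the charts cover. *)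
Record manifold (R : realType) (m : nat) := Manifold {
  points :> topologicalType;
  chart : Type;
  dom : chart -> set points;
  coord : chart -> points -> 'rV[R]_m;
  icoord : chart -> 'rV[R]_m -> points;
  chart_at : points -> chart;
  points_hausdorff : hausdorff_space points;
  points_second_countable : @second_countable points;
  dom_chart_at : forall p, dom (chart_at p) p;
  dom_open : forall c, open (dom c);
  cod_open : forall c, open (coord c @` dom c);
  coordK : forall c p, dom c p -> icoord c (coord c p) = p;
  coord_cts : forall c p, dom c p -> {for p, continuous (coord c)};
  icoord_cts : forall c p, dom c p -> {for coord c p, continuous (icoord c)};
  transition_smooth : forall c c',
    smooth_on (coord c' \o icoord c) (coord c @` (dom c `&` dom c'))
}.

Definition cod (R : realType) (m : nat) (M : manifold R m) (c : chart M) :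
    set 'rV[R]_m :=
  coord c @` dom c.

(** The local expression of [f : M -> N] in the charts [c] of [M] and [c'] of [N]. *)
Definition local_map (R : realType) (m p : nat) (M : manifold R m)
    (N : manifold R p) (f : M -> N) (c : chart M) (c' : chart N) :
    'rV[R]_m -> 'rV[R]_p :=
  fun x => coord c' (f (icoord c x)).

Definition smooth_map (R : realType) (m p : nat) (M : manifold R m)
    (N : manifold R p) (f : M -> N) : Prop :=
  continuous f /\
  forall (c : chart M) (c' : chart N),
    smooth_on (local_map f c c') (coord c @` (dom c `&` f @^-1` dom c')).

Definition smooth_function_on (R : realType) (m : nat) (M : manifold R m)
    (f : M -> R) (U : set M) : Prop :=
  forall c : chart M, smooth_on (fun x => f (icoord c x)) (coord c @` (dom c `&` U)).

(** Smoothness of [(p, t) |-> f p t] on the open subset [U x R^x] of [M x R],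
    where [(x, t)] is encoded as [row_mx x t%:M]. *)
Definition smooth_on_times_Rx (R : realType) (m p : nat) (M : manifold R m)
    (N : manifold R p) (f : M -> R -> N) (U : set M) : Prop :=
  (forall q t, U q -> t != 0 ->
     {for (q, t), continuous (fun z : M * R => f z.1 z.2)}) /\
  forall (c : chart M) (c' : chart N),
    smooth_on
      (fun w : 'rV[R]_(m + 1) =>
         coord c' (f (icoord c (lsubmx w)) (rsubmx w 0 0)))
      [set w | [/\ (coord c @` (dom c `&` U)) (lsubmx w), rsubmx w 0 0 != 0 &
                   dom c' (f (icoord c (lsubmx w)) (rsubmx w 0 0))]].

(** ** Vector and tensor fields

    Fields are given by their local representatives in all charts, subject to the
    transformation law. *)

Definition vfield (R : realType) (m : nat) (M : manifold R m) :=
  chart M -> 'rV[R]_m -> 'rV[R]_m.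

Definition is_vfield (R : realType) (m : nat) (M : manifold R m) (X : vfield M) : Prop :=
  (forall c, smooth_on (X c) (cod c)) /\
  (forall c c' (p : M), dom c p -> dom c' p ->
     X c' (coord c' p) = X c (coord c p) *m 'J (local_map idfun c c') (coord c p)).

Definition tfield (R : realType) (m : nat) (M : manifold R m) (k : nat) :=
  chart M -> 'rV[R]_m -> 'M[R]_(k, m) -> R.

Definition is_tensor (R : realType) (m k : nat) (M : manifold R m)
    (T : tfield M k) : Prop :=
  [/\ forall c x, cod c x -> multilinear (T c x),
      forall c V, smooth_on (fun x => T c x V) (cod c) &
      forall c c' (p : M), dom c p -> dom c' p -> forall V,
        T c (coord c p) V =
        T c' (coord c' p) (V *m 'J (local_map idfun c c') (coord c p))].

Definition is_form (R : realType) (m k : nat) (M : manifold R m)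
    (w : tfield M k) : Prop :=
  is_tensor w /\ forall c x, cod c x -> alternating (w c x).

Definition tfield_eq (R : realType) (m k : nat) (M : manifold R m)
    (S T : tfield M k) : Prop :=
  forall c x, cod c x -> forall V, S c x V = T c x V.

(** [(d w)(v_0, ..., v_k) = \sum_i (-1)^i (D_{v_i} w)(v_0, ..., ^v_i, ..., v_k)] *)
Definition ext_d (R : realType) (m k : nat) (M : manifold R m)
    (w : tfield M k) : tfield M k.+1 :=
  fun c x V =>
    \sum_(i < k.+1) (-1) ^+ i * 'D_(row i V) (fun y => w c y (row' i V)) x.

(** [(L_X T)_{a_1 ... a_k} = X^b d_b T_{a_1 ... a_k} + \sum_i (d_{a_i} X^b) T_{a_1 ... b ... a_k}] *)
Definition lie (R : realType) (m k : nat) (M : manifold R m) (X : vfield M)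
    (T : tfield M k) : tfield M k :=
  fun c x V =>
    'D_(X c x) (fun y => T c y V) x +
    \sum_(i < k) T c x (set_row i ('D_(row i V) (X c) x) V).

Definition homogeneous (R : realType) (m k : nat) (M : manifold R m)
    (X : vfield M) (lambda : R) (T : tfield M k) : Prop :=
  tfield_eq (lie X T) (fun c x V => lambda * T c x V).

(** ** Hodge theory of an oriented pseudo-Riemannian manifold *)

(** [o c p] is [1] or [-1] according to whether the chart [c] is positively or
    negatively oriented at [p]. *)
Definition is_orientation (R : realType) (m : nat) (M : manifold R m)
    (o : chart M -> M -> R) : Prop :=
  [/\ forall c p, dom c p -> o c p = 1 \/ o c p = -1,
      forall c p, dom c p -> \forall q \near p, o c q = o c p &
      forall c c' (p : M), dom c p -> dom c' p ->
        o c' p = Num.sg (\det ('J (local_map idfun c c') (coord c p))) * o c p].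

Definition gram (R : realType) (m : nat) (M : manifold R m) (g : tfield M 2)
    (c : chart M) (x : 'rV[R]_m) : 'M[R]_m :=
  \matrix_(i < m, j < m)
    g c x (col_mx (delta_mx 0 i : 'rV[R]_m) (delta_mx 0 j : 'rV[R]_m)).

(** In the next four definitions, [sgn c x] is the sign of the coordinate frame of
    the chart [c] at the point with coordinates [x], for the given orientation. *)
Definition metric_volume (R : realType) (m : nat) (M : manifold R m)
    (G : tfield M 2) (sgn : chart M -> 'rV[R]_m -> R) : tfield M m :=
  fun c x V => sgn c x * Num.sqrt `|\det (gram G c x)| * \det V.

Definition hodge (R : realType) (m : nat) (M : manifold R m)
    (G : tfield M 2) (sgn : chart M -> 'rV[R]_m -> R) (k l : nat)
    (xi : tfield M k) : tfield M l :=
  fun c x =>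
    hodge_covector (invmx (gram G c x)) (metric_volume G sgn c x) (xi c x).

(** For [k = 0] or [k > m] this is zero. *)
Definition codiff (R : realType) (m : nat) (M : manifold R m)
    (G : tfield M 2) (sgn : chart M -> 'rV[R]_m -> R) (k : nat)
    (xi : tfield M k) : tfield M k.-1 :=
  fun c x V =>
    (-1) ^+ (1 + k * (m - k)) *
    hodge G sgn (l := k.-1) (ext_d (hodge G sgn (l := m - k) xi)) c x V.

(** In degree [0] the term [d (delta xi)] vanishes, [delta xi] being in degree [-1]. *)
Definition hodge_de_rham (R : realType) (m : nat) (M : manifold R m)
    (G : tfield M 2) (sgn : chart M -> 'rV[R]_m -> R) (k : nat) :
    tfield M k -> tfield M k :=
  match k with
  | 0 => fun xi => codiff G sgn (ext_d xi)
  | k'.+1 => fun xi c x V =>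
      ext_d (codiff G sgn xi) c x V + codiff G sgn (ext_d xi) c x V
  end.

(** ** Principal [R^x]-bundles *)

(** [phi : U x R^x -> proj^-1(U)] is an equivariant diffeomorphism over [U] with
    inverse [p |-> (proj p, tau p)]. *)
Definition is_trivialization (R : realType) (n : nat) (P : manifold R (n + 1))
    (M : manifold R n) (proj : P -> M) (act : R -> P -> P)
    (U : set M) (phi : M -> R -> P) (tau : P -> R) : Prop :=
  [/\ forall y t, U y -> t != 0 -> proj (phi y t) = y /\ tau (phi y t) = t,
      forall p, U (proj p) -> tau p != 0 /\ phi (proj p) (tau p) = p,
      forall a y t, a != 0 -> t != 0 -> U y -> act a (phi y t) = phi y (a * t),
      smooth_on_times_Rx phi U &
      smooth_function_on tau (proj @^-1` U)].

(** Only the values [act a] with [a != 0] matter. *)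
Record principal_bundle (R : realType) (n : nat) := PrincipalBundle {
  total_space : manifold R (n + 1);
  base : manifold R n;
  proj : total_space -> base;
  act : R -> total_space -> total_space;
  act1 : forall p, act 1 p = p;
  actM : forall a b p, a != 0 -> b != 0 -> act (a * b) p = act a (act b p);
  act_smooth : smooth_on_times_Rx (fun p a => act a p) setT;
  proj_smooth : smooth_map proj;
  locally_trivial : forall y : base, exists U phi tau,
    [/\ open U, U y & is_trivialization proj act U phi tau]
}.

(** The velocity at [s = 0] of [s |-> e^s . p]. *)
Definition euler (R : realType) (n : nat) (B : principal_bundle R n) :
    vfield (total_space B) :=
  fun c x => derive1 (fun s : R => coord c (act (expR s) (icoord c x))) 0.

Definition vertical (R : realType) (n : nat) (B : principal_bundle R n)
    (c : chart (total_space B)) (x v : 'rV[R]_(n + 1)) : Prop :=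
  forall b : chart (base B), dom b (proj (icoord c x)) ->
    v *m 'J (local_map (@proj R n B) c b) x = 0.

Definition is_carrollian (R : realType) (n : nat) (B : principal_bundle R n)
    (g : tfield (total_space B) 2) : Prop :=
  [/\ is_tensor g,
      forall c x, cod c x -> forall u v : 'rV[R]_(n + 1),
        g c x (col_mx u v) = g c x (col_mx v u),
      forall X : vfield (total_space B), is_vfield X ->
        ((forall c x, cod c x -> forall v, g c x (col_mx (X c x) v) = 0) <->
         (forall c x, cod c x -> vertical c x (X c x))),
      forall c x, cod c x -> forall v : 'rV[R]_(n + 1), 0 <= g c x (col_mx v v) &
      forall c x, cod c x -> \rank (gram g c x) = n].

Definition is_connection_form (R : realType) (n : nat) (B : principal_bundle R n)
    (theta : tfield (total_space B) 1) : Prop :=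
  [/\ is_form theta,
      forall (a : R) (c c' : chart (total_space B)) (p : total_space B),
        a != 0 -> dom c p -> dom c' (act a p) -> forall v,
        theta c' (coord c' (act a p)) (v *m 'J (local_map (act a) c c') (coord c p)) =
        theta c (coord c p) v &
      forall c x, cod c x -> theta c x (euler c x) = 1].

Definition lorentz_metric (R : realType) (n : nat) (B : principal_bundle R n)
    (g : tfield (total_space B) 2) (theta : tfield (total_space B) 1) :
    tfield (total_space B) 2 :=
  fun c x V => g c x V - theta c x (row 0 V) * theta c x (row 1 V).

(** Let [y^1, ..., y^n] be the coordinates of a chart [b] of the base at the
    projection of the point. The determinant below is
      [(pi^* dy^1 /\ ... /\ pi^* dy^n /\ theta)(d_1, ..., d_(n+1))],
    [d_i] being the coordinate frame of [c]; the forms [pi^* dy^a] annihilate the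
    Euler field and are an oriented coframe exactly when [b] is positively oriented.
    So the sign obtained is that of [d_1, ..., d_(n+1)] for the orientation of the
    total space in which [e^1 /\ ... /\ e^n /\ theta] is positive. *)
Definition total_sign (R : realType) (n : nat) (B : principal_bundle R n)
    (o : chart (base B) -> base B -> R) (theta : tfield (total_space B) 1)
    (c : chart (total_space B)) (x : 'rV[R]_(n + 1)) : R :=
  let y := proj (icoord c x) in
  let b := chart_at y in
  o b y *
  Num.sg (\det (row_mx ('J (local_map (@proj R n B) c b) x)
                       (\col_(i < n + 1) theta c x (delta_mx 0 i)))).

(* Main.v *)
(** The Euler field [X] preserves every ingredient of the Hodge-de Rham Laplacian,
    so that operator maps homogeneous forms to homogeneous forms of the same weight.

    - [lie X] commutes with [ext_d] (equality of mixed partial derivatives).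
    - [lie X theta = 0] is the infinitesimal form of the invariance of [theta], so
      [lie X g = 0] gives [lie X G = 0] for [G = g - theta (x) theta].
    - [lie X G = 0] implies that [lie X] commutes with the Hodge star. Pointwise the
      star has the closed form [*xi (W) = < vol (., W), xi >], which is natural under
      linear isomorphisms. Pull it back by the first-order flow [x + s X(x)], with
      differential [1 + s DX]: the pulled-back metric is stationary at [s = 0], hence
      so are its inverse and its volume density, and the derivative of the pulled-back
      star at [s = 0] only sees the derivative of [xi].

    That the results are smooth forms relies on the same closed form, on the
    non-degeneracy of [G] (the kernel of [g] is the line spanned by [X], and
    [theta X = 1]), and on the local constancy of the orientation sign. *)
From mathcomp Require Import all_boot all_order all_algebra fingroup perm.
From mathcomp Require Import all_classical all_reals all_analysis.
From mathcomp Require Import ring.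
Require Import Defs.
Set Implicit Arguments.
Unset Strict Implicit.
Unset Printing Implicit Defensive.
Import Order.TTheory GRing.Theory Num.Theory.
Import numFieldNormedType.Exports.
Local Open Scope classical_set_scope.
Local Open Scope ring_scope.

(** * Multilinear algebra and the Hodge star *)

(** [hodge_covector] is a choice among the solutions of the defining identity, so it says nothing
    until existence and uniqueness are known. With [invmx] written as adjugate over determinant, the
    resulting formula is linear in [xi], with coefficients polynomial in the Gram entries, the
    inverse of their determinant and the volume density. One abstract closure lemma, [fmod_star],
    then yields smoothness and weight alike. A straight segment stands in for the flow because [lie]
    sees only first order, so no integral curves have to be constructed. A covector is a bare
    function on matrices; the derivative of [T (g y) (M y)] is therefore split into base-point and
    argument terms by expanding on basis tuples near the point. Since the operators obey no calculus
    on an arbitrary [tfield], the weight is always propagated together with [is_form]. *)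

Lemma perm_extension (k m : nat) (j f : 'I_k -> 'I_m) :
  injective j -> injective f -> exists s : 'S_m, forall r, s (j r) = f r.
Proof.
move=> ij inf.
(* An injective family is completed to an enumeration of ['I_m] by appending the indices it misses;
   the permutation matches the enumerations of [j] and [f] position by position. *)
pose L (h : 'I_k -> 'I_m) := codom h ++ [seq x <- enum 'I_m | x \notin codom h].
have Lu h : injective h -> uniq (L h).
  move=> hi; rewrite cat_uniq filter_uniq ?enum_uniq // andbT.
  apply/andP; split; first by apply/injectiveP.
  by apply/hasPn => x; rewrite mem_filter => /andP[].
have Lmem h x : x \in L h.
  by rewrite mem_cat mem_filter mem_enum inE andbT orbN.
have Ls h : injective h -> size (L h) = m.
  move=> hi; rewrite -[RHS](size_enum_ord m); apply: perm_size.
  apply: uniq_perm; rewrite ?Lu ?enum_uniq // => x.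
  by rewrite Lmem mem_enum.
pose s0 x := nth x (L f) (index x (L j)).
have lt x : (index x (L j) < size (L f))%N.
  by rewrite (Ls f inf) -[X in (_ < X)%N](Ls j ij) index_mem.
have s0i : injective s0.
  move=> x y; rewrite /s0 (set_nth_default y) // => /eqP.
  rewrite nth_uniq ?Lu // => /eqP e.
  by rewrite -(nth_index x (Lmem j x)) e nth_index.
exists (perm s0i) => r; rewrite permE /s0.
have -> : index (j r) (L j) = r.
  rewrite /L index_cat codom_f /codom /image_mem.
  by rewrite index_map // /index -/(index r (enum 'I_k)) index_enum_ord.
rewrite nth_cat size_codom card_ord ltn_ord /codom (nth_map r) ?size_enum_ord //.
by rewrite nth_ord_enum.
Qed.

(** All fibres of [s |-> s \o j] over injective tuples have the same size: each is a coset of the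
    permutations fixing the image of [j], of which there are [(m - k)!]. *)
Lemma sum_perm_restrict (R : pzRingType) (k m : nat) (j : 'I_k -> 'I_m)
    (h : {ffun 'I_k -> 'I_m} -> R) : injective j ->
  \sum_(s : 'S_m) h [ffun r => s (j r)] =
  (m - k)`!%:R * \sum_(f : {ffun 'I_k -> 'I_m} | injectiveb f) h f.
Proof.
move=> ij.
rewrite (partition_big (fun s : 'S_m => [ffun r => s (j r)])
   (fun f : {ffun 'I_k -> 'I_m} => injectiveb f)) /=; last first.
  by move=> s _; apply/injectiveP => a b; rewrite !ffunE => /perm_inj/ij.
rewrite mulr_sumr; apply: eq_bigr => f /injectiveP fi.
rewrite (eq_bigr (fun _ => h f)); last by move=> s /eqP ->.
rewrite sumr_const mulr_natl; congr (_ *+ _).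
have [s0 s0E] := perm_extension ij fi.
pose S := ~: [set j r | r in 'I_k]%SET.
have cS : #|S| = (m - k)%N.
  by rewrite cardsCs finset.setCK card_imset // !card_ord.
rewrite -cS -card_perm -[RHS](card_imset _ (mulIg s0)).
apply: eq_card => s; transitivity ([ffun r => s (j r)] == f); first by [].
apply/eqP/imsetP.
  move=> sE; exists (mulg s (invg s0)); last by rewrite mulgKV.
  apply/fintype.subsetP => x; rewrite !inE => xs.
  apply: contra xs => /imsetP[r _ ->]; rewrite permM.
  by move/ffunP: sE => /(_ r); rewrite ffunE => ->; rewrite -s0E permK.
move=> [t] tS ->; apply/ffunP => r; rewrite ffunE permM.
by rewrite (out_perm tS) ?s0E // inE negbK imset_f.
Qed.

Section SetRow.
Variables (R : realType) (k m : nat).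
Implicit Types (V : 'M[R]_(k, m)).

Lemma set_rowE i w V a b :
  @set_row R k m i w V a b = if a == i then w 0 b else V a b.
Proof. by rewrite mxE. Qed.

Lemma row_set_row i w V r :
  row r (@set_row R k m i w V) = if r == i then w else row r V.
Proof. by apply/rowP => b; rewrite !mxE; case: eqP => // _; rewrite mxE. Qed.

Lemma set_row_id i V : set_row i (row i V) V = V.
Proof. by apply/matrixP => a b; rewrite !mxE; case: eqP => // ->. Qed.

Lemma set_row_set_row i u w V : set_row i u (set_row i w V) = set_row i u V.
Proof. by apply/matrixP => a b; rewrite !mxE; case: eqP. Qed.

Lemma set_rowC i j u w V : i != j ->
  set_row i u (set_row j w V) = set_row j w (set_row i u V).
Proof.
move=> ij; apply/matrixP => a b; rewrite !mxE.
by case: eqP => // ->; rewrite (negPf ij).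
Qed.

End SetRow.

Lemma row_row_perm (R : Type) (k m : nat) (s : 'S_k) (V : 'M[R]_(k, m)) r :
  row r (row_perm s V) = row (s r) V.
Proof. by apply/rowP => b; rewrite !mxE. Qed.

Section Multilinear.
Variables (R : realType) (k m : nat).
Implicit Types (T : 'M[R]_(k, m) -> R) (V : 'M[R]_(k, m)).

Lemma multilinear0 T i V : multilinear T -> T (set_row i 0 V) = 0.
Proof.
move=> Tl; have := Tl i 1 0 0 V; rewrite scale1r addr0 mul1r.
by move/eqP; rewrite -subr_eq subrr => /eqP.
Qed.

Lemma multilinearZ T i a u V : multilinear T ->
  T (set_row i (a *: u) V) = a * T (set_row i u V).
Proof. by move=> Tl; rewrite -[a *: u]addr0 Tl multilinear0 // addr0. Qed.

Lemma multilinearD T i u v V : multilinear T ->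
  T (set_row i (u + v) V) = T (set_row i u V) + T (set_row i v V).
Proof. by move=> Tl; rewrite -[u]scale1r Tl mul1r scale1r. Qed.

Lemma multilinear_sum T i (I : finType) (u : I -> 'rV[R]_m) V : multilinear T ->
  T (set_row i (\sum_a u a) V) = \sum_a T (set_row i (u a) V).
Proof.
move=> Tl; apply: (big_ind2 (fun x y => T (set_row i x V) = y)) => //.
- exact: multilinear0.
- by move=> x1 x2 y1 y2 <- <-; rewrite multilinearD.
Qed.

Lemma multilinear_ext T1 T2 : multilinear T1 -> multilinear T2 ->
  (forall f : {ffun 'I_k -> 'I_m}, T1 (rowsub f 1%:M) = T2 (rowsub f 1%:M)) ->
  T1 =1 T2.
Proof.
move=> T1l T2l E.
(* [n] bounds the leading rows that are still arbitrary; the rows from [n] on are already basis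
   vectors. *)
suff H : forall n V, (n <= k)%N ->
    (forall r : 'I_k, (n <= r)%N -> exists a, row r V = delta_mx 0 a) ->
    T1 V = T2 V.
  by move=> V; apply: (H k V) => // r; rewrite leqNgt ltn_ord.
elim=> [|n IH] V nk Vb.
  have /fin_all_exists[f fE] : forall r : 'I_k, exists a, row r V = delta_mx 0 a.
    by move=> r; apply: Vb.
  suff -> : V = rowsub [ffun r => f r] 1%:M by [].
  by apply/row_matrixP => r; rewrite fE row_rowsub ffunE row1.
pose i := Ordinal nk.
rewrite -(set_row_id i V) [row i V]row_sum_delta !multilinear_sum //.
apply: eq_bigr => a _; rewrite !multilinearZ //; congr (_ * _).
apply: IH => [|r nr]; first exact: ltnW.
rewrite row_set_row; case: eqP => [_|ri]; first by exists a.
apply: Vb; rewrite ltn_neqAle nr andbT.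
by apply/eqP => e; apply: ri; apply/val_inj.
Qed.

Lemma multilinear_expand T V : multilinear T ->
  T V = \sum_(f : {ffun 'I_k -> 'I_m}) (\prod_r V r (f r)) * T (rowsub f 1%:M).
Proof.
move=> Tl; apply: (multilinear_ext (T2 := fun V =>
  \sum_(f : {ffun 'I_k -> 'I_m}) (\prod_r V r (f r)) * T (rowsub f 1%:M))) => //.
- move=> i a u v W; rewrite mulr_sumr -big_split /=; apply: eq_bigr => f _.
  have E w : \prod_r (set_row i w W) r (f r)
      = w 0 (f i) * \prod_(r < k | r != i) W r (f r).
    rewrite (bigD1 i) //= mxE eqxx; congr (_ * _).
    by apply: eq_bigr => r ri; rewrite mxE (negPf ri).
  by rewrite !E !mxE !mulrDl !mulrA.
- move=> h; rewrite (bigD1 h) //= [X in _ + X]big1 ?addr0 => [|f fh].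
    rewrite big1 ?mul1r // => r _; by rewrite !mxE eqxx.
  have /existsP[r hr] : [exists r, h r != f r].
    apply: contraR fh; rewrite negb_exists => /forallP fh.
    by apply/eqP/ffunP => r; apply/esym/eqP; rewrite -[_ == _]negbK fh.
  by rewrite (bigD1 r) //= !mxE (negPf hr) !mul0r.
Qed.

(** Polarisation: [T] vanishes when rows [i] and [j] both equal the sum of the two original rows,
    and expanding leaves the two mixed terms. *)
Lemma alternating_tperm T i j V : multilinear T -> alternating T -> i != j ->
  T (row_perm (tperm i j) V) = - T V.
Proof.
move=> Tl Ta ij; apply/eqP; rewrite -addr_eq0 addrC; apply/eqP.
pose F u w := T (set_row i u (set_row j w V)).
have F0 u : F u u = 0.
  apply: (Ta _ i j) => //; rewrite !row_set_row eqxx.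
  by rewrite eq_sym (negPf ij) eqxx.
have FDl u u' w : F (u + u') w = F u w + F u' w by rewrite /F multilinearD.
have FDr u w w' : F u (w + w') = F u w + F u w'.
  by rewrite /F !(set_rowC _ _ _ ij) multilinearD.
have := F0 (row i V + row j V); rewrite FDl !FDr !F0 addr0 add0r.
rewrite {1}/F -set_rowC // 1?eq_sym // => <-.
congr (_ + _).
  by rewrite set_rowC // 1?eq_sym // !set_row_id.
congr T; apply/row_matrixP => r; rewrite !row_set_row row_row_perm.
case: tpermP => [->|->|/eqP/negPf -> /eqP/negPf -> //].
  by rewrite eqxx.
by rewrite eq_sym (negPf ij) eqxx.
Qed.

Lemma alternating_perm T (s : 'S_k) V : multilinear T -> alternating T ->
  T (row_perm s V) = (-1) ^+ s * T V.
Proof.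
move=> Tl Ta; have [ts -> /allP tsd] := prod_tpermP s.
elim: ts tsd V => [|[i j] ts IH] tsd V.
  by rewrite big_nil row_perm1 odd_perm1 mul1r.
have ij : i != j by exact: (tsd (i, j) (mem_head _ _)).
rewrite big_cons row_permM /= alternating_tperm //.
rewrite IH; last by move=> x xs; apply: tsd; rewrite inE xs orbT.
rewrite odd_permM odd_tperm ij.
by rewrite signr_addb expr1 mulN1r mulNr.
Qed.

Lemma alternating_basis0 T (f : {ffun 'I_k -> 'I_m}) :
  alternating T -> ~~ injectiveb f -> T (rowsub f 1%:M) = 0.
Proof.
move=> Ta /injectivePn[i [j ij fij]]; apply: (Ta _ i j) => //.
by rewrite !row_rowsub fij.
Qed.

(** Expansion of [T] by components times minors; ordered tuples count every increasing one [k!]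
    times. The non-injective tuples contribute zero, so they are added back and the full sum is
    reindexed by each permutation of the Leibniz formula. *)
Lemma alternating_minors T V : multilinear T -> alternating T ->
  \sum_(f : {ffun 'I_k -> 'I_m} | injectiveb f)
     T (rowsub f 1%:M) * \det (colsub f V) = k`!%:R * T V.
Proof.
move=> Tl Ta.
have -> : k`!%:R * T V = \sum_(s : 'S_k) T V.
  by rewrite sumr_const card_Sn mulr_natl.
rewrite big_mkcond /=.
rewrite (eq_bigr (fun f : {ffun 'I_k -> 'I_m} => \sum_(s : 'S_k)
   T (rowsub f 1%:M) * ((-1) ^+ s * \prod_r V r (f (s r))))); last first.
  move=> f _; rewrite -mulr_sumr.
  case: ifP => [_|/negbT fi]; last by rewrite alternating_basis0 // mul0r.
  congr (_ * _); apply: eq_bigr => s _; congr (_ * _).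
  by apply: eq_bigr => r _; rewrite mxE.
rewrite exchange_big; apply: eq_bigr => s _ /=.
rewrite [RHS]multilinear_expand //.
rewrite [RHS](reindex_inj (h := fun f : {ffun 'I_k -> 'I_m} => [ffun r => f (s r)])) /=.
  apply: eq_bigr => f _; rewrite mulrCA mulrA mulrC; congr (_ * _).
    by apply: eq_bigr => r _; rewrite ffunE.
  rewrite -alternating_perm //; congr T.
  by apply/row_matrixP => r; rewrite row_row_perm !row_rowsub ffunE.
move=> f g /ffunP fg; apply/ffunP => r.
by have := fg (s^-1 r)%g; rewrite !ffunE permKV.
Qed.

End Multilinear.

Lemma alternating_det (R : realType) (m : nat) (T : 'M[R]_m -> R) V :
  multilinear T -> alternating T -> T V = T 1%:M * \det V.
Proof.
move=> Tl Ta; rewrite [LHS]multilinear_expand // mulr_sumr.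
pose h (f : {ffun 'I_m -> 'I_m}) := (\prod_r V r (f r)) * T (rowsub f 1%:M).
(* In top degree the injective tuples are exactly the permutations, and the fibre factor is
   [0! = 1]. *)
have := @sum_perm_restrict R m m id h (@inj_id _).
rewrite subnn fact0 mul1r => hE.
rewrite (bigID (fun f : {ffun 'I_m -> 'I_m} => injectiveb f)) /= [X in _ + X]big1 ?addr0 -?hE.
  apply: eq_bigr => s _; rewrite /h.
  have -> : T (rowsub [ffun r => s (id r)] 1%:M) = (-1) ^+ s * T 1%:M.
    rewrite -alternating_perm //; congr T.
    by apply/row_matrixP => r; rewrite row_row_perm row_rowsub ffunE.
  under eq_bigr do rewrite ffunE.
  by rewrite [LHS]mulrC mulrCA mulrA.
by move=> f fi; rewrite alternating_basis0 // mulr0.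
Qed.

(** * Wedge products with determinants and the closed form of the Hodge star *)

Section HodgeFormula.
Variable R : realType.

Lemma det_multilinear (m : nat) (c : R) :
  multilinear (fun V : 'M[R]_m => c * \det V).
Proof.
move=> i a u v V; rewrite (determinant_multilinear (i0 := i)
  (B := set_row i u V) (C := set_row i v V) (b := a) (c := 1)) ?mul1r.
- by rewrite mulrDr mulrCA.
- by rewrite !row_set_row eqxx scale1r.
- by apply/matrixP => r b; rewrite !mxE eq_sym (negPf (neq_lift _ _)).
- by apply/matrixP => r b; rewrite !mxE eq_sym (negPf (neq_lift _ _)).
Qed.

Lemma det_alternating (m : nat) (c : R) :
  alternating (fun V : 'M[R]_m => c * \det V).
Proof.
move=> V i j ij rij; rewrite (determinant_alternate ij) ?mulr0 // => b.
by move/rowP: rij => /(_ b); rewrite !mxE.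
Qed.

Section Sum.
Variables k l m : nat.

Lemma set_row_col_mxu i (w : 'rV[R]_m) (U : 'M[R]_(k, m)) (W : 'M[R]_(l, m)) :
  set_row (lshift l i) w (col_mx U W) = col_mx (set_row i w U) W.
Proof.
apply/row_matrixP => r; rewrite row_set_row; case: (split_ordP r) => r' ->.
  by rewrite eq_lshift !rowKu row_set_row.
by rewrite eq_rlshift !rowKd.
Qed.

Lemma set_row_col_mxd i (w : 'rV[R]_m) (U : 'M[R]_(k, m)) (W : 'M[R]_(l, m)) :
  set_row (rshift k i) w (col_mx U W) = col_mx U (set_row i w W).
Proof.
apply/row_matrixP => r; rewrite row_set_row; case: (split_ordP r) => r' ->.
  by rewrite eq_lrshift !rowKu.
by rewrite eq_rshift !rowKd row_set_row.
Qed.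

Lemma multilinear_col_mxu (T : 'M[R]_(k + l, m) -> R) W :
  multilinear T -> multilinear (fun U => T (col_mx U W)).
Proof. by move=> Tl i a u v V; rewrite -!set_row_col_mxu Tl. Qed.

Lemma multilinear_col_mxd (T : 'M[R]_(k + l, m) -> R) U :
  multilinear T -> multilinear (fun W => T (col_mx U W)).
Proof. by move=> Tl i a u v V; rewrite -!set_row_col_mxd Tl. Qed.

Lemma alternating_col_mxu (T : 'M[R]_(k + l, m) -> R) W :
  alternating T -> alternating (fun U => T (col_mx U W)).
Proof.
move=> Ta V i j ij rij; apply: (Ta _ (lshift l i) (lshift l j)).
  by rewrite eq_lshift.
by rewrite !rowKu.
Qed.

Lemma alternating_col_mxd (T : 'M[R]_(k + l, m) -> R) U :
  alternating T -> alternating (fun W => T (col_mx U W)).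
Proof.
move=> Ta V i j ij rij; apply: (Ta _ (rshift k i) (rshift k j)).
  by rewrite eq_rshift.
by rewrite !rowKd.
Qed.

Lemma multilinear_wedge (a : 'M[R]_(k, m) -> R) (b : 'M[R]_(l, m) -> R) :
  multilinear a -> multilinear b -> multilinear (wedge a b).
Proof.
move=> al bl i t u v V; rewrite /wedge [t * _]mulrCA -mulrDr; congr (_ * _).
rewrite mulr_sumr -big_split /=; apply: eq_bigr => s _.
rewrite [t * _]mulrCA -mulrDr; congr (_ * _).
(* The changed row sits at position [s^-1 i] after permuting, hence in exactly one of the two blocks
   fed to [a] and [b]. *)
have E w : row_perm s (set_row i w V) = set_row ((s^-1)%g i) w (row_perm s V).
  apply/row_matrixP => r; rewrite row_row_perm !row_set_row row_row_perm.
  by rewrite (canF_eq (permK s)).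
have V1 : row_perm s V = col_mx (usubmx (row_perm s V)) (dsubmx (row_perm s V)).
  by rewrite vsubmxK.
rewrite !E V1; case: (split_ordP ((s^-1)%g i)) => r ->.
  by rewrite !set_row_col_mxu !col_mxKu !col_mxKd al mulrDl mulrA.
by rewrite !set_row_col_mxd !col_mxKu !col_mxKd bl mulrDr mulrCA.
Qed.

(** Summing over all permutations is enough: composing with the transposition of the two equal rows
    keeps every argument and flips the sign, so the sum is its own opposite. *)
Lemma alternating_wedge (a : 'M[R]_(k, m) -> R) (b : 'M[R]_(l, m) -> R) :
  alternating (wedge a b).
Proof.
move=> V i j ij rij; rewrite /wedge; set S := \sum_s _.
suff : S = - S.
  by move/eqP; rewrite -addr_eq0 -mulr2n mulrn_eq0 /= => /eqP ->; rewrite mulr0.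
rewrite {1}/S (reindex_inj (mulIg (tperm i j))) /= -sumrN.
apply: eq_bigr => s _.
have -> : row_perm (s * tperm i j)%g V = row_perm s V.
  apply/row_matrixP => r; rewrite !row_row_perm permM.
  by case: tpermP => [->|->|].
by rewrite odd_permM odd_tperm ij signr_addb expr1 mulrN1 mulNr.
Qed.

End Sum.

Section Complement.
Variables k l : nat.
Let m := (k + l)%N.

(** The last [l] rows are the basis vectors [s] assigns to the second block; permuting the columns
    by [s] makes the matrix block triangular with an identity corner, and the complementary minor of
    [U] remains. *)
Lemma det_col_mxd (U : 'M[R]_(k, k + l)) (s : 'S_(k + l)) :
  \det (col_mx U (dsubmx (row_perm s 1%:M))) =
  (-1) ^+ s * \det (colsub (s \o @lshift k l) U).
Proof.
set M := col_mx _ _.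
have E : col_perm s M = block_mx (colsub (s \o @lshift k l) U)
    (colsub (s \o @rshift k l) U) 0 1%:M.
  apply/matrixP => a b; rewrite mxE /M.
  case: (split_ordP a) => a' ->; case: (split_ordP b) => b' ->.
  - by rewrite block_mxEul col_mxEu mxE.
  - by rewrite block_mxEur col_mxEu mxE.
  - rewrite block_mxEdl col_mxEd !mxE (inj_eq (@perm_inj _ s)).
    by rewrite eq_rlshift.
  - rewrite block_mxEdr col_mxEd !mxE (inj_eq (@perm_inj _ s)).
    by rewrite eq_rshift.
have := congr1 determinant E; rewrite det_ublock det1 mulr1 => <-.
rewrite col_permE det_mulmx det_perm odd_permV mulrCA -expr2 sqrr_sign mulr1 //.
Qed.

Lemma det_col_mxu (W : 'M[R]_(l, k + l)) (s : 'S_(k + l)) :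
  \det (col_mx (usubmx (row_perm s 1%:M)) W) =
  (-1) ^+ s * \det (colsub (s \o @rshift k l) W).
Proof.
set M := col_mx _ _.
have E : col_perm s M = block_mx 1%:M 0 (colsub (s \o @lshift k l) W)
    (colsub (s \o @rshift k l) W).
  apply/matrixP => a b; rewrite mxE /M.
  case: (split_ordP a) => a' ->; case: (split_ordP b) => b' ->.
  - rewrite block_mxEul col_mxEu !mxE (inj_eq (@perm_inj _ s)).
    by rewrite eq_lshift.
  - rewrite block_mxEur col_mxEu !mxE (inj_eq (@perm_inj _ s)).
    by rewrite eq_lrshift.
  - by rewrite block_mxEdl col_mxEd mxE.
  - by rewrite block_mxEdr col_mxEd mxE.
have := congr1 determinant E; rewrite det_lblock det1 mul1r => <-.
rewrite col_permE det_mulmx det_perm odd_permV mulrCA -expr2 sqrr_sign mulr1 //.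
Qed.

(** The constant is the number of permutations inducing a given subset of [p] indices; it is what
    the normalisation in [wedge] cancels. *)
Lemma wedge_minors (p : nat) (j : 'I_p -> 'I_(k + l)) (T : 'M[R]_(p, k + l) -> R)
    (U : 'M[R]_(p, k + l)) : injective j -> multilinear T -> alternating T ->
  \sum_(s : 'S_(k + l)) T (rowsub (s \o j) 1%:M) * \det (colsub (s \o j) U) =
  (p`! * (k + l - p)`!)%:R * T U.
Proof.
move=> ji Tl Ta.
pose h (f : {ffun 'I_p -> 'I_(k + l)}) := T (rowsub f 1%:M) * \det (colsub f U).
have := sum_perm_restrict h ji; rewrite alternating_minors // mulrA -natrM mulnC.
move=> <-; apply: eq_bigr => s _.
by rewrite /h; congr (_ * _); [congr T|congr determinant];
  apply/matrixP => a b; rewrite !mxE ffunE.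
Qed.

(** Both sides are top-degree alternating in [V], so it suffices to compare them on the standard
    frame, where the wedge becomes a sum of components of [zeta] times minors of [W]. This gives
    uniqueness of the star; [wedge_det_r] gives existence. *)
Lemma wedge_det_l (zeta : 'M[R]_(l, k + l) -> R) (W : 'M[R]_(l, k + l)) V :
  multilinear zeta -> alternating zeta ->
  wedge (fun U : 'M[R]_(k, k + l) => \det (col_mx U W)) zeta V
    = zeta W * \det V.
Proof.
move=> zl za; rewrite (alternating_det V (T := wedge _ _)).
- congr (_ * _); rewrite /wedge.
  have -> : zeta W = ((k`! * l`!)%:R)^-1 * ((l`! * (k + l - l)`!)%:R * zeta W).
    by rewrite addnK mulnC mulrA mulVf ?mul1r // pnatr_eq0 -lt0n muln_gt0 !fact_gt0.
  congr (_ * _); rewrite -(wedge_minors (j := @rshift k l)) //.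
    apply: eq_bigr => s _; rewrite det_col_mxu -mulrA signrMK mulrC.
    congr (zeta _ * _); apply/row_matrixP => r.
    by rewrite row_dsubmx row_row_perm row_rowsub.
  exact: rshift_inj.
- have := @det_multilinear (k + l) 1; move=> /(@multilinear_col_mxu k l _ _ W) H.
  apply: multilinear_wedge => // i a u v U.
  by have := H i a u v U; rewrite !mul1r.
- exact: alternating_wedge.
Qed.

Lemma wedge_det_r (eta : 'M[R]_(k, k + l) -> R) (U : 'M[R]_(k, k + l)) V :
  multilinear eta -> alternating eta ->
  wedge eta (fun W : 'M[R]_(l, k + l) => \det (col_mx U W)) V
    = eta U * \det V.
Proof.
move=> zl za; rewrite (alternating_det V (T := wedge _ _)).
- congr (_ * _); rewrite /wedge.
  have -> : eta U = ((k`! * l`!)%:R)^-1 * ((k`! * (k + l - k)`!)%:R * eta U).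
    by rewrite addKn mulrA mulVf ?mul1r // pnatr_eq0 -lt0n muln_gt0 !fact_gt0.
  congr (_ * _); rewrite -(wedge_minors (j := @lshift k l)) //.
    apply: eq_bigr => s _; rewrite det_col_mxd mulrCA signrMK.
    congr (eta _ * _); apply/row_matrixP => r.
    by rewrite row_usubmx row_row_perm row_rowsub.
  exact: lshift_inj.
- have := @det_multilinear (k + l) 1; move=> /(@multilinear_col_mxd k l _ _ U) H.
  apply: multilinear_wedge => // i a u v W.
  by have := H i a u v W; rewrite !mul1r.
- exact: alternating_wedge.
Qed.

End Complement.

(** [c] is the value of the volume form on the coordinate frame. The slots of [U] precede those of
    [W], in accordance with the convention [eta /\ star xi]. *)
Definition star_covector (m k l : nat) (Ginv : 'M[R]_m) (c : R)
    (xi : 'M[R]_(k, m) -> R) (W : 'M[R]_(l, m)) : R :=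
  covector_inner Ginv
    (fun U => c * \det (conform_mx (0 : 'M[R]_m) (col_mx U W))) xi.

Lemma wedge_sumr (m k l : nat) (I : finType) (a : 'M[R]_(k, m) -> R)
    (b : I -> 'M[R]_(l, m) -> R) (c : I -> R) V :
  wedge a (fun W => \sum_i c i * b i W) V = \sum_i c i * wedge a (b i) V.
Proof.
rewrite /wedge mulr_sumr.
under eq_bigr do rewrite mulr_sumr mulr_sumr mulr_sumr.
under [RHS]eq_bigr do rewrite mulrCA mulr_sumr mulr_sumr.
rewrite exchange_big; apply: eq_bigr => i _; apply: eq_bigr => s _ /=.
by congr (_ * _); rewrite [RHS]mulrCA; congr (_ * _); rewrite mulrCA.
Qed.

Lemma star_covectorP (m k l : nat) (Ginv : 'M[R]_m) (c : R)
    (xi : 'M[R]_(k, m) -> R) : (k + l)%N = m ->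
  is_hodge_covector Ginv (fun V => c * \det V) xi
    (star_covector (l := l) Ginv c xi).
Proof.
move=> e; case: m / e Ginv xi => Ginv xi.
(* The coefficients writing the star as a combination of the forms [\det (col_mx e_i _)], one for
   each pair of index tuples; [wedge_det_r] then applies term by term. *)
pose K (ij : {ffun 'I_k -> 'I_(k + l)} * {ffun 'I_k -> 'I_(k + l)}) : R :=
  (k`!%:R)^-1 * (\prod_r Ginv (ij.1 r) (ij.2 r)) * c * xi (rowsub ij.2 1%:M).
have innerE (a : 'M[R]_(k, k + l) -> R) :
    covector_inner Ginv a xi * c =
    \sum_ij K ij * a (rowsub ij.1 1%:M).
  rewrite /covector_inner pair_bigA /= mulr_sumr mulr_suml.
  by apply: eq_bigr => -[i j] _ /=; rewrite /K /=; ring.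
have E : star_covector Ginv c xi = fun W : 'M[R]_(l, k + l) =>
    \sum_ij K ij * \det (col_mx (rowsub ij.1 1%:M) W).
  apply/funext => W; rewrite -(innerE (fun U => \det (col_mx U W))) /star_covector.
  rewrite /covector_inner -!mulrA mulr_suml; congr (_ * _).
  apply: eq_bigr => i _; rewrite mulr_suml; apply: eq_bigr => j _.
  by rewrite conform_mx_id; ring.
rewrite E; split.
- move=> i a u v V; rewrite mulr_sumr -big_split; apply: eq_bigr => ij _ /=.
  have := multilinear_col_mxd (rowsub ij.1 1%:M) (@det_multilinear (k + l) 1).
  by move=> /(_ i a u v V); rewrite !mul1r => ->; rewrite mulrDr mulrCA.
- move=> V i j ij rij; rewrite big1 // => f _.
  have := alternating_col_mxd (rowsub f.1 1%:M) (@det_alternating (k + l) 1).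
  by move=> /(_ V i j ij rij); rewrite mul1r => ->; rewrite mulr0.
- move=> eta el ea V; rewrite wedge_sumr conform_mx_id mulrA innerE mulr_suml.
  by apply: eq_bigr => f _; rewrite wedge_det_r // mulrA.
Qed.

Lemma hodge_covectorE (m k l : nat) (Ginv : 'M[R]_m) (c : R)
    (xi : 'M[R]_(k, m) -> R) : (k + l)%N = m ->
  hodge_covector (l := l) Ginv (fun V => c * \det V) xi = star_covector Ginv c xi.
Proof.
move=> e; rewrite /hodge_covector e eqxx.
apply: xget_subset1; first exact: star_covectorP.
move=> z1 z2 h1 h2.
suff H (z : 'M[R]_(l, m) -> R) : is_hodge_covector Ginv (fun V => c * \det V) xi z ->
    z = star_covector Ginv c xi by rewrite (H z1) // (H z2) //.
case: m / e Ginv xi z {z1 z2 h1 h2} => Ginv xi z [zl za zE]; apply/funext => W.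
(* Testing a candidate against this form reads off its value at [W], by [wedge_det_l]; so two
   candidates agree. *)
have := zE (fun U => \det (col_mx U W)).
have dl : multilinear (fun U : 'M[R]_(k, k + l) => \det (col_mx U W)).
  have := multilinear_col_mxu W (@det_multilinear (k + l) 1).
  by move=> H i a u v V; have := H i a u v V; rewrite !mul1r.
have da : alternating (fun U : 'M[R]_(k, k + l) => \det (col_mx U W)).
  have := alternating_col_mxu W (@det_alternating (k + l) 1).
  by move=> H V i j ij rij; have := H V i j ij rij; rewrite !mul1r.
move=> /(_ dl da 1%:M); rewrite wedge_det_l // conform_mx_id det1 !mulr1 => ->.
rewrite /star_covector /covector_inner -mulrA; congr (_ * _).
rewrite mulr_suml; apply: eq_bigr => i _; rewrite mulr_suml; apply: eq_bigr => j _.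
by rewrite conform_mx_id; ring.
Qed.

(** Expanding the pulled-back components brings in one entry of [B] per slot. Exchanging the sum
    over index tuples with the product over slots contracts them with [Ginv] separately in each
    slot. *)
Lemma covector_inner_mul (m k : nat) (Ginv B : 'M[R]_m) (a b : 'M[R]_(k, m) -> R) :
  multilinear a -> multilinear b ->
  covector_inner Ginv (fun U => a (U *m B)) (fun U => b (U *m B)) =
  covector_inner (B^T *m Ginv *m B) a b.
Proof.
move=> al bl; rewrite /covector_inner; congr (_ * _).
have rE (i : {ffun 'I_k -> 'I_m}) : rowsub i 1%:M *m B = rowsub i B.
  by rewrite mul_rowsub_mx mul1mx.
under eq_bigr do under eq_bigr do
  rewrite !rE (multilinear_expand _ al) (multilinear_expand _ bl).
pose F (i j f h : {ffun 'I_k -> 'I_m}) : R :=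
  (\prod_r (B (i r) (f r) * Ginv (i r) (j r) * B (j r) (h r))) *
  (a (rowsub f 1%:M) * b (rowsub h 1%:M)).
transitivity (\sum_i \sum_j \sum_f \sum_h F i j f h).
  apply: eq_bigr => i _; apply: eq_bigr => j _.
  rewrite mulr_suml mulr_sumr; apply: eq_bigr => f _.
  rewrite !mulr_sumr; apply: eq_bigr => h _.
  rewrite /F !big_split /=.
  have -> : \prod_r rowsub i B r (f r) = \prod_r B (i r) (f r).
    by apply: eq_bigr => r _; rewrite mxE.
  have -> : \prod_r rowsub j B r (h r) = \prod_r B (j r) (h r).
    by apply: eq_bigr => r _; rewrite mxE.
  by ring.
transitivity (\sum_f \sum_h \sum_i \sum_j F i j f h).
  transitivity (\sum_i \sum_f \sum_h \sum_j F i j f h).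
    apply: eq_bigr => i _; rewrite exchange_big; apply: eq_bigr => f _ /=.
    by rewrite exchange_big.
  rewrite exchange_big; apply: eq_bigr => f _ /=.
  by rewrite exchange_big.
apply: eq_bigr => f _; apply: eq_bigr => h _.
under eq_bigr do rewrite -mulr_suml.
rewrite -mulr_suml; congr (_ * _).
have -> : \prod_r (B^T *m Ginv *m B) (f r) (h r) =
    \prod_r \sum_(p : 'I_m * 'I_m) B p.1 (f r) * Ginv p.1 p.2 * B p.2 (h r).
  apply: eq_bigr => r _; rewrite mxE.
  rewrite -(pair_bigA _ (fun p q => B p (f r) * Ginv p q * B q (h r))) /=.
  rewrite exchange_big; apply: eq_bigr => q _ /=.
  by rewrite mxE mulr_suml; apply: eq_bigr => p _; rewrite mxE.
rewrite bigA_distr_bigA /= pair_bigA /=.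
(* A tuple of index pairs is the same thing as a pair of index tuples. *)
rewrite (reindex (fun g : {ffun 'I_k -> 'I_m * 'I_m} =>
   ([ffun r => (g r).1], [ffun r => (g r).2]))) /=.
  by apply: eq_bigr => g _; apply: eq_bigr => r _; rewrite !ffunE.
exists (fun p : {ffun 'I_k -> 'I_m} * {ffun 'I_k -> 'I_m} =>
    [ffun r => (p.1 r, p.2 r)]) => [g _|[i j] _] /=.
  by apply/ffunP => r; rewrite !ffunE -surjective_pairing.
by congr (_, _); apply/ffunP => r; rewrite !ffunE.
Qed.

(** Naturality of the star. Vectors are rows, so the pulled-back Gram matrix is [B G B^T]. The
    density picks up the signed [\det B]; [volume_pull] reconciles this with the absolute value in
    the metric density. *)
Lemma star_covector_mul (m k l : nat) (G B : 'M[R]_m) (c : R)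
    (xi : 'M[R]_(k, m) -> R) (W : 'M[R]_(l, m)) : (k + l)%N = m ->
  multilinear xi -> B \in unitmx -> G \in unitmx ->
  star_covector (invmx (B *m G *m B^T)) (c * \det B) (fun V => xi (V *m B)) W =
  star_covector (invmx G) c xi (W *m B).
Proof.
move=> e xil Bu Gu; rewrite /star_covector.
have aE (U : 'M[R]_(k, m)) :
    c * \det B * \det (conform_mx (0 : 'M[R]_m) (col_mx U W)) =
    c * \det (conform_mx (0 : 'M[R]_m) (col_mx (U *m B) (W *m B))).
  case: m / e B U W {G xi xil Bu Gu} => B U W.
  by rewrite !conform_mx_id -mul_col_mx det_mulmx; ring.
set a := fun U : 'M[R]_(k, m) => c * \det (conform_mx (0 : 'M[R]_m) (col_mx U (W *m B))).
under eq_fun do rewrite aE -/(a _).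
have al : multilinear a.
  rewrite /a; case: m / e B W {a aE Bu G Gu xi xil} => B W.
  move=> i t u v V; rewrite !conform_mx_id.
  exact: (multilinear_col_mxu (W *m B) (@det_multilinear (k + l) c) i t u v V).
rewrite covector_inner_mul //; congr (covector_inner _ _ _).
have BGu : B *m G *m B^T \in unitmx by rewrite !unitmx_mul Bu Gu unitmx_tr.
set I := invmx _.
have key : G *m (B^T *m I *m B) = 1%:M.
  rewrite -[LHS](mulKmx Bu).
  have -> : B *m (G *m (B^T *m I *m B)) = B *m G *m B^T *m I *m B.
    by rewrite !mulmxA.
  by rewrite mulmxV // mul1mx mulVmx.
by rewrite -[LHS](mulKmx Gu) key mulmx1.
Qed.

End HodgeFormula.

(** * Differential calculus *)

Section Calculus.
Variable R : realType.

(** The two maps share a first-order expansion at [x], and the linear part of such an expansion is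
    unique. *)
Lemma near_eq_differentiable (V W : normedModType R) (f g : V -> W) (x : V) :
  (\near x, f x = g x) -> differentiable f x -> differentiable g x.
Proof.
move=> fg df.
have fgx : f x = g x by exact: nbhs_singleton fg.
have E : g \o shift x = cst (g x) + 'd f x +o_ 0 id.
  apply/eqaddoP => e e0.
  have /eqaddoP/(_ e e0) := diff_locally df.
  have : \forall y \near (0 : V), f (y + x) = g (y + x).
    have := fg; rewrite (near_shift 0) subr0; apply: filterS => y /=.
    by rewrite addrC.
  move=> h1 h2; near=> y.
  have H1 : f (y + x) = g (y + x) by near: y.
  have : `|((f \o shift x) - (cst (f x) + 'd f x)) y| <= e * `|y| by near: y.
  by rewrite !fctE /= H1 fgx.
apply/diff_locallyP; have H := diff_unique (diff_continuous df) E.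
by rewrite H; split => //; exact: diff_continuous.
Unshelve. all: by end_near. Qed.

Lemma differentiable_rV (V : normedModType R) (p : nat) (f : V -> 'rV[R]_p) x :
  (forall j, differentiable (fun y => f y 0 j) x) -> differentiable f x.
Proof.
move=> df.
have -> : f = \sum_(j < p) (fun y => f y 0 j *: (delta_mx 0 j : 'rV[R]_p)).
  by apply/funext => y; rewrite fct_sumE [LHS]row_sum_delta.
by apply: differentiable_sum => j; apply: differentiableZl.
Qed.

Lemma differentiable_rV_coord (V : normedModType R) (p : nat)
    (f : V -> 'rV[R]_p) x j :
  differentiable f x -> differentiable (fun y => f y 0 j) x.
Proof.
move=> df; apply: (differentiable_comp (g := fun u : 'rV[R]_p => u 0 j)) => //.
exact: differentiable_coord.
Qed.

Lemma is_derive_chain (V W : normedModType R) (p : nat) (g : V -> 'rV[R]_p)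
    (f : 'rV[R]_p -> W) x v :
  differentiable g x -> differentiable f (g x) ->
  is_derive x v (fun y => f (g y)) ('D_('D_v g x) f (g x)).
Proof.
move=> dg df; have dfg := differentiable_comp dg df.
apply: DeriveDef; first exact: diff_derivable.
by rewrite (deriveE _ dfg) diff_comp //= (deriveE _ dg) (deriveE _ df).
Qed.

Lemma is_derive_mulf (V : normedModType R) (f g : V -> R) x v df dg :
  is_derive x v f df -> is_derive x v g dg ->
  is_derive x v (fun y => f y * g y) (df * g x + f x * dg).
Proof.
move=> hf hg; apply: (is_derive_eq (is_deriveM hf hg)).
by rewrite addrC mulrC.
Qed.

Lemma is_derive_addf (V W : normedModType R) (f g : V -> W) x v df dg :
  is_derive x v f df -> is_derive x v g dg ->
  is_derive x v (fun y => f y + g y) (df + dg).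
Proof. exact: is_deriveD. Qed.

Lemma is_derive_E (V W : normedModType R) (f : V -> W) x v df :
  is_derive x v f df -> 'D_v f x = df.
Proof. by case. Qed.

Lemma derive_coord (V : normedModType R) (p q : nat) (f : V -> 'M[R]_(p, q)) x v i j :
  derivable f x v -> ('D_v f x) i j = 'D_v (fun y => f y i j) x.
Proof. by move=> df; rewrite derive_mx // mxE. Qed.

Lemma is_derive_coord (V : normedModType R) (p : nat) (f : V -> 'rV[R]_p) x v i j :
  differentiable f x -> is_derive x v (fun y => f y i j) (('D_v f x) i j).
Proof.
move=> df; rewrite (ord1 i) derive_coord; last exact: diff_derivable.
by apply: derivableP; apply: diff_derivable; exact: differentiable_rV_coord.
Qed.

Lemma is_derive_sumf (V W : normedModType R) (I : finType) (f : I -> V -> W) x v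
    (df : I -> W) :
  (forall i, is_derive x v (f i) (df i)) ->
  is_derive x v (fun y => \sum_i f i y) (\sum_i df i).
Proof.
move=> H.
have -> : (fun y => \sum_i f i y) = \sum_i f i by apply/funext => y; rewrite fct_sumE.
by elim/big_ind2 : _ => // [|] *; [exact: is_derive_cst|exact: is_deriveD].
Qed.

Lemma is_derive_prodf (V : normedModType R) (k : nat) (f : 'I_k -> V -> R) x v
    (df : 'I_k -> R) :
  (forall i, is_derive x v (f i) (df i)) ->
  is_derive x v (fun y => \prod_i f i y)
    (\sum_(i < k) \prod_(r < k) (if r == i then df r else f r x)).
Proof.
elim: k f df => [|k IH] f df H.
  rewrite big_ord0; have -> : (fun y => \prod_(i < 0) f i y) = cst 1.
    by apply/funext => y; rewrite big_ord0.
  exact: is_derive_cst.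
have -> : (fun y => \prod_(i < k.+1) f i y) =
    fun y => f ord0 y * \prod_(i < k) f (lift ord0 i) y.
  by apply/funext => y; rewrite big_ord_recl.
apply: (is_derive_eq (is_derive_mulf (H ord0) (IH _ _ (fun i => H (lift ord0 i))))).
rewrite [RHS]big_ord_recl; congr (_ + _).
  by rewrite [RHS]big_ord_recl eqxx; congr (_ * _); apply: eq_bigr.
rewrite mulr_sumr; apply: eq_bigr => i _.
rewrite [RHS]big_ord_recl /=; congr (_ * _).
Qed.

(** Leibniz rule for a tensor whose base point and arguments both move. On basis tuples it is a
    finite sum of products of entries of [M] with component functions of [T], to which the scalar
    rules apply. *)
Lemma is_derive_tensor (V : normedModType R) (k p : nat)
    (T : 'rV[R]_p -> 'M[R]_(k, p) -> R) (g : V -> 'rV[R]_p)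
    (M : V -> 'M[R]_(k, p)) x v (N : 'M[R]_(k, p)) :
  differentiable g x ->
  (\forall z \near g x, multilinear (T z)) ->
  (forall A, differentiable (fun z => T z A) (g x)) ->
  (forall i j, is_derive x v (fun y => M y i j) (N i j)) ->
  is_derive x v (fun y => T (g y) (M y))
    ('D_('D_v g x) (fun z => T z (M x)) (g x) +
     \sum_(i < k) T (g x) (set_row i (row i N) (M x))).
Proof.
move=> dg Tl dT dM.
pose E (f : {ffun 'I_k -> 'I_p}) : 'M[R]_(k, p) := rowsub f 1%:M.
have Tx : multilinear (T (g x)) by exact: nbhs_singleton Tl.
(* The expansion is available only where [T] is multilinear, hence only near [x]; that is enough for
   a derivative. *)
have near_eq : \forall y \near x,
    \sum_(f : {ffun 'I_k -> 'I_p}) (\prod_r M y r (f r)) * T (g y) (E f) =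
    T (g y) (M y).
  have gc : g y @[y --> x] --> g x by exact: differentiable_continuous.
  have : \forall y \near x, multilinear (T (g y)) by exact: (gc _ Tl).
  by apply: filterS => y Ty; rewrite [RHS]multilinear_expand.
have D1 : is_derive x v (fun y => \sum_(f : {ffun 'I_k -> 'I_p})
      (\prod_r M y r (f r)) * T (g y) (E f))
    (\sum_(f : {ffun 'I_k -> 'I_p})
      ((\sum_(i < k) \prod_(r < k) (if r == i then N r (f r) else M x r (f r))) *
          T (g x) (E f) +
       (\prod_r M x r (f r)) * 'D_('D_v g x) (fun z => T z (E f)) (g x))).
  apply: is_derive_sumf => f; apply: is_derive_mulf.
    by apply: is_derive_prodf => i.
  exact: is_derive_chain.
apply: (is_derive_eq (near_eq_is_derive near_eq D1)).
rewrite big_split [RHS]addrC; congr (_ + _) => /=.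
  under eq_bigr do rewrite mulr_suml.
  rewrite exchange_big; apply: eq_bigr => i _ /=.
  rewrite [RHS]multilinear_expand //; apply: eq_bigr => f _; congr (_ * _).
  by apply: eq_bigr => r _; rewrite !mxE; case: eqP => // ->.
(* The remaining terms are the derivative of the same expansion with the arguments frozen at
   [M x]. *)
have near_eq2 : \forall z \near g x,
    \sum_(f : {ffun 'I_k -> 'I_p}) (\prod_r M x r (f r)) * T z (E f) =
    T z (M x).
  by apply: filterS Tl => z Tz; rewrite [RHS]multilinear_expand.
rewrite -(near_eq_derive ('D_v g x) near_eq2).
have : is_derive (g x) ('D_v g x)
   (fun z => \sum_(f : {ffun 'I_k -> 'I_p}) (\prod_r M x r (f r)) * T z (E f))
   (\sum_(f : {ffun 'I_k -> 'I_p})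
      (0 * T (g x) (E f) + (\prod_r M x r (f r)) *
         'D_('D_v g x) (fun z => T z (E f)) (g x))).
  apply: is_derive_sumf => f.
  have h1 : is_derive (g x) ('D_v g x) (fun=> \prod_r M x r (f r)) 0.
    exact: is_derive_cst.
  have h2 : is_derive (g x) ('D_v g x) (fun z => T z (E f))
      ('D_('D_v g x) (fun z => T z (E f)) (g x)).
    by apply: derivableP; exact: diff_derivable.
  exact: is_derive_mulf h1 h2.
move=> /@derive_val ->; apply: eq_bigr => f _; by rewrite mul0r add0r.
Qed.

Lemma is_derive_tensor_id (k p : nat) (T : 'rV[R]_p -> 'M[R]_(k, p) -> R)
    (M : 'rV[R]_p -> 'M[R]_(k, p)) x v (N : 'M[R]_(k, p)) :
  (\forall z \near x, multilinear (T z)) ->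
  (forall A, differentiable (fun z => T z A) x) ->
  (forall i j, is_derive x v (fun y => M y i j) (N i j)) ->
  is_derive x v (fun y => T y (M y))
    ('D_v (fun z => T z (M x)) x +
     \sum_(i < k) T x (set_row i (row i N) (M x))).
Proof.
move=> Tl dT dM.
have did : differentiable (idfun : 'rV[R]_p -> 'rV[R]_p) x by exact: ex_diff.
have D := is_derive_tensor did Tl dT dM.
by rewrite (derive_id x v) in D.
Qed.

End Calculus.

(** * Closure properties of smooth functions and symmetry of second derivatives *)

Section Smooth.
Variable R : realType.

Section General.
Variables (m : nat) (W : normedModType R).
Implicit Types (f g : 'rV[R]_m -> W) (U : set 'rV[R]_m).

Lemma Ck_on_ext r f g U : open U -> (forall x, U x -> f x = g x) ->
  Ck_on r f U -> Ck_on r g U.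
Proof.
move=> oU; have nU x : U x -> \forall y \near x, U y by move=> Ux; exact: open_nbhs_nbhs.
elim: r f g => [|r IH] f g fg /=.
  move=> fc x Ux; have fgx := fg _ Ux.
  rewrite /prop_for /continuous_at -fgx; apply: cvg_trans (fc x Ux).
  have fgn : \forall y \near x, f y = g y by apply: filterS (nU x Ux) => y /fg.
  exact: near_eq_cvg fgn.
move=> [df Df]; split=> [x Ux|v].
  apply: near_eq_differentiable (df x Ux).
  by apply: filterS (nU x Ux) => y /fg.
apply: IH (Df v) => x Ux; apply: near_eq_derive.
by apply: filterS (nU x Ux) => y /fg.
Qed.

Lemma Ck_on_subset r f U U' : U' `<=` U -> Ck_on r f U -> Ck_on r f U'.
Proof.
move=> sU; elim: r f => [|r IH] f /=; first by move=> fc x /sU/fc.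
by move=> [df Df]; split=> [x /sU/df //|v]; exact: IH.
Qed.

Lemma Ck_onW r f U : Ck_on r.+1 f U -> Ck_on r f U.
Proof.
elim: r f => [|r IH] f.
  by move=> [df _] x /df /differentiable_continuous.
move=> [df Df]; split; first exact: df.
by move=> v; exact: IH (Df v).
Qed.

(** [Ck_on] is a pointwise condition on derivatives in the ambient space, so each point may use its
    own [U']. Needed for the volume density, whose signs are constant only locally. *)
Lemma Ck_on_local r f U :
  (forall x, U x -> exists2 U', U' x & Ck_on r f U') -> Ck_on r f U.
Proof.
elim: r f => [|r IH] f H /=.
  by move=> x /H[U' U'x]; apply.
split=> [x /H[U' U'x [df _]]|v]; first exact: df.
by apply: IH => x /H[U' U'x [_ Df]]; exists U' => //; exact: Df.
Qed.

Lemma Ck_on_cst r (a : W) U : Ck_on r (fun=> a) U.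
Proof.
elim: r a => [|r IH] a /=; first by move=> x _; exact: cst_continuous.
split=> [x _|v]; first exact: differentiable_cst.
have -> : (fun x => 'D_v (fun=> a) x) = fun=> 0 by apply/funext => x; rewrite derive_cst.
exact: IH.
Qed.

Lemma Ck_onD r f g U : open U -> Ck_on r f U -> Ck_on r g U ->
  Ck_on r (fun x => f x + g x) U.
Proof.
move=> oU; elim: r f g => [|r IH] f g /=.
  by move=> fc gc x Ux; apply: continuousD; [exact: fc|exact: gc].
move=> [df Df] [dg Dg]; split=> [x Ux|v].
  by apply: differentiableD; [exact: df|exact: dg].
apply: Ck_on_ext oU _ (IH _ _ (Df v) (Dg v)) => x Ux.
by rewrite deriveD //; apply: diff_derivable; [exact: df|exact: dg].
Qed.

End General.

Section Scalar.
Variable m : nat.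
Implicit Types (f g : 'rV[R]_m -> R) (U : set 'rV[R]_m).

Lemma Ck_onM r f g U : open U -> Ck_on r f U -> Ck_on r g U ->
  Ck_on r (fun x => f x * g x) U.
Proof.
move=> oU; elim: r f g => [|r IH] f g.
  by move=> fc gc x Ux; apply: continuousM; [exact: fc|exact: gc].
move=> f1 g1; move: (f1) (g1) => [df Df] [dg Dg]; split=> [x Ux|v].
  by apply: differentiableM; [exact: df|exact: dg].
apply: Ck_on_ext oU _ (Ck_onD oU (IH _ _ (Df v) (Ck_onW g1)) (IH _ _ (Ck_onW f1) (Dg v))).
move=> x Ux; apply/esym; apply: derive_val.
by apply: is_derive_mulf; apply: derivableP; apply: diff_derivable;
  [exact: df|exact: dg].
Qed.

Lemma Ck_onN r f U : open U -> Ck_on r f U -> Ck_on r (fun x => - f x) U.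
Proof.
move=> oU fr; apply: Ck_on_ext oU _ (Ck_onM oU (@Ck_on_cst m R r (-1) U) fr).
by move=> x _; rewrite mulN1r.
Qed.

(** The derivative [- f^-2 D f] involves the inverse itself, which the induction hypothesis already
    makes of class [r]; the square root is handled in the same way. *)
Lemma Ck_onV r f U : open U -> (forall x, U x -> f x != 0) -> Ck_on r f U ->
  Ck_on r (fun x => (f x)^-1) U.
Proof.
move=> oU f0; elim: r => [|r IH] fr.
  by move=> x Ux; apply: continuousV; [exact: f0|exact: fr].
move: (fr) => [df Df]; split=> [x Ux|v].
  by apply: differentiableV; [exact: df|exact: f0].
have Vr := IH (Ck_onW fr).
apply: Ck_on_ext oU _ (Ck_onN oU (Ck_onM oU (Ck_onM oU Vr Vr) (Df v))).
move=> x Ux; rewrite deriveV ?f0 //; last by apply: diff_derivable; exact: df.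
by rewrite -mulNr /GRing.scale /= -expr2 exprVn.
Qed.

Lemma Ck_on_sqrt r f U : open U -> (forall x, U x -> 0 < f x) -> Ck_on r f U ->
  Ck_on r (fun x => Num.sqrt (f x)) U.
Proof.
move=> oU f0.
have sd x : U x -> differentiable f x ->
    differentiable (fun x => Num.sqrt (f x)) x.
  move=> Ux df; apply: (differentiable_comp (g := Num.sqrt)) => //.
  by apply/derivable1_diffP; have [] := is_derive1_sqrt (f0 _ Ux).
elim: r => [|r IH] fr.
  move=> x Ux; apply: continuous_comp; first exact: fr.
  exact: sqrt_continuous.
move: (fr) => [df Df]; split=> [x Ux|v]; first by apply: sd => //; exact: df.
have Sr := IH (Ck_onW fr).
have h0 x : U x -> 2 * Num.sqrt (f x) != 0.
  by move=> Ux; rewrite mulf_neq0 // ?pnatr_eq0 // gt_eqF // sqrtr_gt0 f0.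
have Vr := Ck_onV oU h0 (Ck_onM oU (@Ck_on_cst m R r 2 U) Sr).
apply: Ck_on_ext oU _ (Ck_onM oU Vr (Df v)) => x Ux.
have dfx := df _ Ux.
rewrite (deriveE _ (sd _ Ux dfx)).
have ds : differentiable Num.sqrt (f x).
  by apply/derivable1_diffP; have [] := is_derive1_sqrt (f0 _ Ux).
rewrite (diff_comp dfx ds) /= -(deriveE _ dfx).
rewrite -[X in 'd _ _ X]mulr1 -[X in 'd _ _ X]/('D_v f x *: 1) linearZ /=.
rewrite -(deriveE _ ds).
by have [_ ->] := is_derive1_sqrt (f0 _ Ux); rewrite mulrC.
Qed.

Lemma smooth_on_sum (I : finType) (f : I -> 'rV[R]_m -> R) U : open U ->
  (forall i, smooth_on (f i) U) -> smooth_on (fun x => \sum_i f i x) U.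
Proof.
move=> oU fr r.
have -> : (fun x => \sum_i f i x) = \sum_i f i by apply/funext => x; rewrite fct_sumE.
elim/big_rec: _ => [|i g _ gr]; first exact: Ck_on_cst.
by apply: Ck_onD => //; exact: fr.
Qed.

End Scalar.

Lemma smooth_on_coord (m p : nat) (f : 'rV[R]_m -> 'rV[R]_p) U j : open U ->
  smooth_on f U -> smooth_on (fun x => f x 0 j) U.
Proof.
move=> oU fs r; have := fs r; elim: r f {fs} => [|r IH] f.
  move=> fc x Ux; apply: (continuous_comp (g := fun u : 'rV[R]_p => u 0 j)).
    exact: fc.
  exact: coord_continuous.
move=> [df Df]; split=> [x Ux|v].
  by apply: differentiable_rV_coord; exact: df.
apply: Ck_on_ext oU _ (IH _ (Df v)) => x Ux.
rewrite derive_mx ?mxE //; apply: diff_derivable; exact: df.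
Qed.

Lemma smooth_on_differentiable (m : nat) (W : normedModType R)
    (f : 'rV[R]_m -> W) U x : smooth_on f U -> U x -> differentiable f x.
Proof. by move=> /(_ 1%N)[+ _]; apply. Qed.

Lemma smooth_on_derive (m : nat) (W : normedModType R)
    (f : 'rV[R]_m -> W) U v : smooth_on f U -> smooth_on (fun x => 'D_v f x) U.
Proof. by move=> fs r; have [_] := fs r.+1; apply. Qed.

(** With [h] affine of linear part [L], a directional derivative of the composite is again a
    composite with [h], in the constant direction [L v], so the induction closes. *)
Lemma smooth_on_affine (m p : nat) (W : normedModType R) (f : 'rV[R]_p -> W)
    (h : 'rV[R]_m -> 'rV[R]_p) (L : 'rV[R]_m -> 'rV[R]_p) U :
  (forall s v x, h (s *: v + x) = s *: L v + h x) ->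
  (forall x, differentiable h x) ->
  smooth_on f U -> smooth_on (fun x => f (h x)) (h @^-1` U).
Proof.
move=> hL dh fs r; have := fs r; elim: r f {fs} => [|r IH] f.
  move=> fc x Ux; apply: continuous_comp; last exact: fc.
  exact: differentiable_continuous.
move=> [df Df]; split=> [x Ux|v].
  by apply: differentiable_comp => //; exact: df.
have -> : (fun x => 'D_v (fun x => f (h x)) x) = fun x => 'D_(L v) f (h x).
  apply/funext => x.
  have E : (fun s : R => s^-1 *: (((fun x => f (h x)) \o shift x) (s *: v) - f (h x)))
      = (fun s => s^-1 *: ((f \o shift (h x)) (s *: L v) - f (h x))).
    by apply/funext => s /=; rewrite hL.
  exact: (congr1 (fun F : R -> W => lim (F @ 0^')) E).
exact: IH (Df (L v)).
Qed.

Lemma is_derive_line (V W : normedModType R) (f : V -> W) (p u : V) (s : R) :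
  derivable f (s *: u + p) u ->
  is_derive s 1 (fun t => f (t *: u + p)) ('D_u f (s *: u + p)).
Proof.
move=> df.
have E : (fun h : R => h^-1 *: (((fun t : R => f (t *: u + p)) \o shift s) (h *: 1)
      - f (s *: u + p))) =
    (fun h => h^-1 *: ((f \o shift (s *: u + p)) (h *: u) - f (s *: u + p))).
  by apply/funext => h /=; rewrite scalerDl addrA [_%:A]mulr1.
apply: DeriveDef; first by move: df; rewrite /derivable -E; apply.
exact: (congr1 (fun F : R -> W => lim (F @ 0^')) E).
Qed.

(** Mean value theorem twice: along [u] for the difference of [f] across [h *: v], then along [v]
    for ['D_u f]. *)
Lemma second_difference (V : normedModType R) (f : V -> R) (x u v : V) (h : R) :
  0 < h ->
  (forall s t, 0 <= s <= h -> 0 <= t <= h -> derivable f (s *: u + (t *: v + x)) u) ->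
  (forall s t, 0 <= s <= h -> 0 <= t <= h ->
     derivable (fun y => 'D_u f y) (s *: u + (t *: v + x)) v) ->
  exists s t, [/\ 0 <= s <= h, 0 <= t <= h &
    f (h *: u + (h *: v + x)) - f (h *: u + x) - f (h *: v + x) + f x =
    h * h * 'D_v (fun y => 'D_u f y) (s *: u + (t *: v + x))].
Proof.
move=> h0 fu fuv.
have hh : 0 <= h <= h by apply/andP; split => //; exact: ltW.
have h00 : (0 : R) <= 0 <= h by apply/andP; split => //; exact: ltW.
pose F s := f (s *: u + (h *: v + x)) - f (s *: u + x).
pose dF s := 'D_u f (s *: u + (h *: v + x)) - 'D_u f (s *: u + x).
have FD s : 0 <= s <= h -> is_derive s 1 F (dF s).
  move=> sh; have fu0 := fu s 0 sh h00; rewrite scale0r add0r in fu0.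
  exact: is_deriveB (is_derive_line (fu s h sh hh)) (is_derive_line fu0).
have in_cc (s : R) : s \in `[0, h] -> 0 <= s <= h by rewrite in_itv.
have in_oo (s : R) : s \in `]0, h[ -> 0 <= s <= h.
  by rewrite in_itv /= => /andP[/ltW -> /ltW ->].
have Fc : {within `[0, h], continuous F}.
  apply: derivable_within_continuous => s /in_cc sh.
  by have [] := FD s sh.
have [a /in_oo ah] := MVT h0 (fun s sh => FD s (in_oo s sh)) Fc.
rewrite /F /dF {FD Fc dF F} !scale0r !add0r subr0 => E1.
pose G t := 'D_u f (a *: u + (t *: v + x)).
have GD t : 0 <= t <= h -> is_derive t 1 G
    ('D_v (fun y => 'D_u f y) (a *: u + (t *: v + x))).
  move=> th.
  have EG : G = fun t => 'D_u f (t *: v + (a *: u + x)).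
    by apply/funext => t'; rewrite /G addrCA.
  rewrite EG addrCA; apply: (is_derive_line (f := fun y => 'D_u f y)).
  by rewrite addrCA; exact: fuv.
have Gc : {within `[0, h], continuous G}.
  apply: derivable_within_continuous => s /in_cc sh.
  by have [] := GD s sh.
have [b /in_oo bh] := MVT h0 (fun s sh => GD s (in_oo s sh)) Gc.
rewrite /G scale0r add0r subr0 => E2.
exists a, b; split => //; rewrite [RHS]mulrC mulrA -E2 -E1; ring.
Qed.

(** Schwarz: the second difference is symmetric in [u] and [v], so it expresses both mixed
    derivatives at points close to [x]; continuity at [x] concludes. *)
Lemma derive_sym (V : normedModType R) (f : V -> R) (x u v : V) :
  (\forall y \near x, [/\ derivable f y u, derivable f y v,
     derivable (fun y => 'D_u f y) y v & derivable (fun y => 'D_v f y) y u]) ->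
  {for x, continuous (fun y => 'D_v (fun y => 'D_u f y) y)} ->
  {for x, continuous (fun y => 'D_u (fun y => 'D_v f y) y)} ->
  'D_v (fun y => 'D_u f y) x = 'D_u (fun y => 'D_v f y) x.
Proof.
move=> H c1 c2; apply/eqP; rewrite -subr_eq0 -normr_le0; apply/ler_addgt0Pl => e e0.
rewrite addr0; have e20 : 0 < e / 2 by rewrite divr_gt0.
have tri (a b p : R) : `|a - p| < e / 2 -> `|b - p| < e / 2 -> `|a - b| <= e.
  move=> n1 n2; rewrite [leRHS]splitr -(subrK p a) -addrA.
  by rewrite (le_trans (ler_normD _ _)) // lerD ?(ltW n1) // distrC ltW.
move/cvgrPdist_lt/(_ _ e20): c1 => N1.
move/cvgrPdist_lt/(_ _ e20): c2 => N2.
have : \forall y \near x, [/\ [/\ derivable f y u, derivable f y v,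
     derivable (fun y => 'D_u f y) y v & derivable (fun y => 'D_v f y) y u],
   `|'D_v (fun y => 'D_u f y) x - 'D_v (fun y => 'D_u f y) y| < e / 2 &
   `|'D_u (fun y => 'D_v f y) x - 'D_u (fun y => 'D_v f y) y| < e / 2].
  apply: filterS (filterI H (filterI N1 N2)) => y [h1 [h2 h3]]; exact: And3 h1 h2 h3.
case/nbhs_normP => d /= d0 Hd.
(* Small enough for the parallelogram of sides [h *: u] and [h *: v] to lie in the ball of radius
   [d]; the [+ 1] keeps the denominator positive when [u] and [v] vanish. *)
pose h := d / 2 / (`|u| + `|v| + 1).
have uv0 : 0 < `|u| + `|v| + 1 by rewrite ltr_wpDl ?addr_ge0.
have h0 : 0 < h by rewrite !divr_gt0.
have inB s t : 0 <= s <= h -> 0 <= t <= h ->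
    ball_ Num.Def.normr x d (s *: u + (t *: v + x)).
  move=> /andP[s0 sh] /andP[t0 th] /=.
  have -> : x - (s *: u + (t *: v + x)) = - (s *: u + t *: v).
    by rewrite [s *: u + (_ + _)]addrA opprD addrCA subrr addr0.
  rewrite normrN (le_lt_trans (ler_normD _ _)) // !normrZ !ger0_norm //.
  have hE : h * (`|u| + `|v| + 1) = d / 2 by rewrite /h divfK // gt_eqF.
  have u0 := normr_ge0 u; have v0 := normr_ge0 v.
  have su : s * `|u| <= h * `|u| by rewrite ler_wpM2r.
  have tv : t * `|v| <= h * `|v| by rewrite ler_wpM2r.
  have dd : d / 2 < d by rewrite ltr_pdivrMr // ltr_pMr // ltr1n.
  apply: (le_lt_trans (lerD su tv)); apply: le_lt_trans dd.
  by rewrite -hE -mulrDr ler_pM2l // lerDl.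
have Hd' s t (sh : 0 <= s <= h) (th : 0 <= t <= h) := Hd _ (inB s t sh th).
have [a [b [ah bh E1]]] := second_difference (f := f) (x := x) (u := u) (v := v) h0
  (fun s t sh th => let: And3 (And4 h1 _ _ _) _ _ := Hd' s t sh th in h1)
  (fun s t sh th => let: And3 (And4 _ _ h1 _) _ _ := Hd' s t sh th in h1).
have Hd2 s t (sh : 0 <= s <= h) (th : 0 <= t <= h) :
    ball_ Num.Def.normr x d (s *: v + (t *: u + x)).
  by rewrite addrCA; exact: inB t s th sh.
have Hd2' s t (sh : 0 <= s <= h) (th : 0 <= t <= h) := Hd _ (Hd2 s t sh th).
have [a' [b' [ah' bh' E2]]] := second_difference (f := f) (x := x) (u := v) (v := u) h0
  (fun s t sh th => let: And3 (And4 _ h1 _ _) _ _ := Hd2' s t sh th in h1)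
  (fun s t sh th => let: And3 (And4 _ _ _ h1) _ _ := Hd2' s t sh th in h1).
have [_ n1 _] := Hd' a b ah bh.
have [_ _ n2] := Hd2' a' b' ah' bh'.
have PQ : 'D_v (fun y => 'D_u f y) (a *: u + (b *: v + x)) =
    'D_u (fun y => 'D_v f y) (a' *: v + (b' *: u + x)).
  apply: (mulfI (x := h * h)); first by rewrite mulf_neq0 // gt_eqF.
  have K (p q r s : R) : p - q - r + s = p - r - q + s by ring.
  apply: etrans (esym E1) (etrans (K _ _ _ _) _); rewrite -[RHS]E2.
  by rewrite [h *: u + (h *: v + x)]addrCA.
rewrite -PQ in n2; exact: tri n1 n2.
Qed.

Lemma smooth_derive_sym (m : nat) (f : 'rV[R]_m -> R) U x u v :
  open U -> smooth_on f U -> U x ->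
  'D_v (fun y => 'D_u f y) x = 'D_u (fun y => 'D_v f y) x.
Proof.
move=> oU fs Ux; apply: derive_sym.
- have : \forall y \near x, U y by exact: open_nbhs_nbhs.
  apply: filterS => y Uy.
  have D w (g : 'rV[R]_m -> R) : smooth_on g U -> derivable g y w.
    by move=> gs; apply: diff_derivable; exact: smooth_on_differentiable gs Uy.
  by split; apply: D => //; exact: smooth_on_derive.
- exact: (smooth_on_derive v (smooth_on_derive u fs) 0%N x Ux).
- exact: (smooth_on_derive u (smooth_on_derive v fs) 0%N x Ux).
Qed.

Lemma smooth_derive_sym_rV (m p : nat) (f : 'rV[R]_m -> 'rV[R]_p) U x u v :
  open U -> smooth_on f U -> U x ->
  'D_v (fun y => 'D_u f y) x = 'D_u (fun y => 'D_v f y) x.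
Proof.
move=> oU fs Ux.
have E (w w' : 'rV[R]_m) : 'D_w' (fun y => 'D_w f y) x =
    \row_j 'D_w' (fun y => 'D_w (fun z => f z 0 j) y) x.
  rewrite derive_mx; last first.
    apply: diff_derivable; exact: smooth_on_differentiable (smooth_on_derive w fs) Ux.
  apply/rowP => j; rewrite !mxE; apply: near_eq_derive.
  have : \forall y \near x, U y by exact: open_nbhs_nbhs.
  apply: filterS => y Uy; rewrite derive_mx ?mxE //.
  by apply: diff_derivable; exact: smooth_on_differentiable fs Uy.
apply: etrans (E u v) (etrans _ (esym (E v u))).
exact: (congr1 (fun h : 'I_p -> R => \row_j h j) (funext (fun j =>
  smooth_derive_sym u v oU (smooth_on_coord j oU fs) Ux))).
Qed.

End Smooth.

(** * The exterior and Lie derivatives of forms *)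

(** Bookkeeping for [lie_ext_d]: [j] is the row changed by the Lie derivative and [i] the row
    [ext_d] differentiates along. The diagonal changes the direction, and [j = lift i r] changes an
    argument. *)
Lemma sum_diag_lift (R : realType) (k : nat) (e A : 'I_k.+1 -> R)
    (F : 'I_k.+1 -> 'I_k.+1 -> R) (B : 'I_k.+1 -> 'I_k -> R) :
  (forall i, F i i = A i) -> (forall i r, F i (lift i r) = B i r) ->
  \sum_j \sum_i e i * F i j = \sum_i e i * A i + \sum_i e i * \sum_r B i r.
Proof.
move=> FA FB; rewrite exchange_big -big_split; apply: eq_bigr => i _ /=.
rewrite (bigD1_ord i) //= FA mulr_sumr; congr (_ + _).
by apply: eq_bigr => r _; rewrite FB.
Qed.

Section Antisymmetry.
Variables (R : realType) (k m : nat).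
Implicit Types (w : 'M[R]_(k, m) -> R) (V : 'M[R]_(k.+1, m)).

Lemma row'_set_row i (u : 'rV[R]_m) V : row' i (set_row i u V) = row' i V.
Proof.
by apply/matrixP => a b; rewrite !mxE eq_sym (negPf (neq_lift _ _)).
Qed.

Lemma row'_set_row_lift i j (u : 'rV[R]_m) V :
  row' i (set_row (lift i j) u V) = set_row j u (row' i V).
Proof. by apply/matrixP => a b; rewrite !mxE (inj_eq lift_inj). Qed.

Lemma row_row' i r V : row r (row' i V) = row (lift i r) V.
Proof. by apply/rowP => b; rewrite !mxE. Qed.

(** Since rows [i] and [j] agree, both submatrices have the same rows, in orders differing by the
    permutation that [tperm i j] induces on the remaining indices. Its sign is that of
    [i + j + 1]. *)
Lemma alternating_row' w V i j : multilinear w -> alternating w -> i != j ->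
  row i V = row j V ->
  (-1) ^+ i * w (row' i V) + (-1) ^+ j * w (row' j V) = 0.
Proof.
move=> wl wa ij rij; pose t := tperm i j.
have /fin_all_exists[s0 s0E] : forall r : 'I_k, exists q, t (lift i r) = lift j q.
  move=> r; have : j != t (lift i r).
    by rewrite -[j in j != _](tpermL i j) (inj_eq perm_inj) neq_lift.
  by move=> /unlift_some[q -> _]; exists q.
have s0i : injective s0.
  by move=> a b ab; have := s0E a; rewrite ab -s0E => /perm_inj/lift_inj.
pose s := perm s0i.
have tE : t = lift_perm i j s.
  apply/permP => r; case: (unliftP i r) => [r' ->|->].
    by rewrite lift_perm_lift s0E /s permE.
  by rewrite lift_perm_id tpermL.
have sE : true = odd i (+) odd j (+) s :> bool.
  by rewrite -odd_lift_perm -tE odd_tperm ij.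
have -> : row' i V = row_perm s (row' j V).
  apply/row_matrixP => r; rewrite row_row_perm !row_row' [s r]permE -s0E.
  by case: tpermP => [->|->|].
rewrite alternating_perm // mulrA -mulrDl.
rewrite -(signr_odd _ i) -(signr_odd _ j) -signr_addb.
have -> : odd i (+) s = ~~ odd j.
  by move: sE; case: (odd i) (odd j) (odd_perm s) => [] [] [].
by rewrite signrN addNr mul0r.
Qed.

(** Kills second derivatives: [h] will be the Hessian of a transition map or of a vector field,
    contracted with an alternating form. The terms for [(i, j)] and [(j, i)] cancel by
    [alternating_row']. *)
Lemma symmetric_sum0 w V (h : 'I_k.+1 -> 'I_k.+1 -> 'rV[R]_m) :
  multilinear w -> alternating w -> (forall i j, h i j = h j i) ->
  \sum_(i < k.+1) (-1) ^+ i *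
    \sum_(r < k) w (set_row r (h i (lift i r)) (row' i V)) = 0.
Proof.
move=> wl wa hs.
pose a i j := if j == i then 0 else
  (-1) ^+ (nat_of_ord i) * w (row' i (set_row j (h i j) V)).
have -> : \sum_(i < k.+1) (-1) ^+ i *
    \sum_(r < k) w (set_row r (h i (lift i r)) (row' i V)) = \sum_i \sum_j a i j.
  apply: eq_bigr => i _; rewrite (bigD1_ord i) //= {1}/a eqxx add0r mulr_sumr.
  apply: eq_bigr => r _.
  by rewrite /a eq_sym (negPf (neq_lift _ _)) row'_set_row_lift.
have aN i j : a i j = - a j i.
  rewrite /a eq_sym; case: eqVneq => [_|ij]; first by rewrite oppr0.
  apply/eqP; rewrite -addr_eq0; apply/eqP.
  (* A row about to be deleted may be changed at will, so rows [i] and [j] can be made equal. *)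
  pose V' := set_row i (h i j) (set_row j (h i j) V).
  have -> : row' i (set_row j (h i j) V) = row' i V' by rewrite row'_set_row.
  have -> : row' j (set_row i (h j i) V) = row' j V'.
    by rewrite /V' set_rowC // row'_set_row hs.
  apply: alternating_row' => //.
  by rewrite !row_set_row eqxx eq_sym (negPf ij) eqxx.
set S := \sum_i _; suff : S = - S.
  by move/eqP; rewrite -addr_eq0 -mulr2n mulrn_eq0 /= => /eqP.
rewrite {1}/S exchange_big -sumrN; apply: eq_bigr => i _ /=.
by rewrite -sumrN; apply: eq_bigr => j _.
Qed.

End Antisymmetry.

Lemma row'_mulmx (R : realType) (k m p : nat) i (V : 'M[R]_(k.+1, m)) (B : 'M[R]_(m, p)) :
  row' i (V *m B) = row' i V *m B.
Proof. by apply/row_matrixP => r; rewrite row_mul !row_row' row_mul. Qed.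

Lemma set_row1 (R : realType) (m : nat) i (u : 'rV[R]_m) (V : 'M[R]_(1, m)) :
  set_row i u V = u.
Proof. by apply/matrixP => a b; rewrite mxE (ord1 a) (ord1 i) eqxx. Qed.


(** * Jacobians and changes of chart *)

Section Jacobian.
Variable R : realType.

Lemma near_eq_jacobian m p (f g : 'rV[R]_m -> 'rV[R]_p) x :
  (\near x, f x = g x) -> differentiable f x -> 'J f x = 'J g x.
Proof.
move=> fg df; have dg := near_eq_differentiable fg df.
have E (v : 'rV[R]_m) : v *m 'J f x = v *m 'J g x.
  apply: etrans (esym (deriveEjacobian v df)) (etrans _ (deriveEjacobian v dg)).
  exact: near_eq_derive.
by apply/row_matrixP => i; apply: etrans (rowE _ _) (etrans (E _) (esym (rowE _ _))).
Qed.

Lemma jacobian_comp m p q (f : 'rV[R]_m -> 'rV[R]_p) (g : 'rV[R]_p -> 'rV[R]_q) x :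
  differentiable f x -> differentiable g (f x) ->
  'J (g \o f) x = 'J f x *m 'J g (f x).
Proof.
move=> df dg; have E (v : 'rV[R]_m) : v *m 'J (g \o f) x = v *m ('J f x *m 'J g (f x)).
  rewrite mulmxA; apply: etrans (esym (deriveEjacobian v (differentiable_comp df dg))) _.
  have [_ D] := is_derive_chain v df dg; apply: etrans D _.
  apply: etrans (deriveEjacobian _ dg) _; congr (_ *m _).
  exact: deriveEjacobian.
by apply/row_matrixP => i; apply: etrans (rowE _ _) (etrans (E _) (esym (rowE _ _))).
Qed.

Lemma jacobian_id m (x : 'rV[R]_m) : 'J idfun x = 1%:M.
Proof.
have E (v : 'rV[R]_m) : v *m 'J idfun x = v *m 1%:M.
  rewrite mulmx1; apply: etrans (esym (deriveEjacobian v _)) (derive_id x v).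
  exact: ex_diff.
by apply/row_matrixP => i; apply: etrans (rowE _ _) (etrans (E _) (esym (rowE _ _))).
Qed.

End Jacobian.

Section Chart.
Variables (R : realType) (m : nat) (M : manifold R m).

Lemma open_coord (c : chart M) (V : set M) : open V -> open (coord c @` (dom c `&` V)).
Proof.
move=> oV; rewrite openE => _ [p [cp Vp] <-].
have co := @cod_open R m M c; rewrite openE in co.
have h1 : nbhs (coord c p) (coord c @` dom c) by apply: co; exists p.
have h2 : nbhs (coord c p) (icoord c @^-1` V).
  apply: (icoord_cts cp); rewrite coordK //.
  exact: open_nbhs_nbhs.
apply: filterS (filterI h1 h2) => y [[q cq <-]] /=; rewrite coordK // => Vq.
by exists q.
Qed.

Lemma cod_coord (c : chart M) p : dom c p -> cod c (coord c p).
Proof. by move=> cp; exists p. Qed.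

Lemma near_cod (c : chart M) x : cod c x -> \forall y \near x, cod c y.
Proof. by move=> cx; apply: open_nbhs_nbhs; split => //; exact: cod_open. Qed.

Lemma near_coord (c : chart M) p (V : set M) : dom c p -> nbhs p V ->
  \forall y \near coord c p, exists q, [/\ dom c q, V q & coord c q = y].
Proof.
move=> cp; rewrite nbhsE => -[V' [oV' V'p] sV].
have oW := open_coord (c := c) oV'.
have : nbhs (coord c p) (coord c @` (dom c `&` V')).
  by apply: open_nbhs_nbhs; split => //; exists p.
by apply: filterS => y [q [cq Vq] <-]; exists q; split => //; exact: sV.
Qed.

Lemma transition_differentiable (c c' : chart M) p : dom c p -> dom c' p ->
  differentiable (local_map idfun c c') (coord c p).
Proof.
move=> cp cp'.
apply: (smooth_on_differentiable (@transition_smooth R m M c c')).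
by exists p.
Qed.

Lemma local_mapE (N : manifold R m) (f : M -> N) (c : chart M) (c' : chart N) p :
  dom c p -> local_map f c c' (coord c p) = coord c' (f p).
Proof. by move=> cp; rewrite /local_map coordK. Qed.

Lemma transition_jacobianK (c c' : chart M) p : dom c p -> dom c' p ->
  'J (local_map idfun c c') (coord c p) *m
  'J (local_map idfun c' c) (coord c' p) = 1%:M.
Proof.
move=> cp cp'.
have tE : local_map idfun c c' (coord c p) = coord c' p.
  by rewrite /local_map coordK.
have d1 := transition_differentiable cp cp'.
have d2 := transition_differentiable cp' cp.
rewrite -[in X in _ *m X]tE -tE in d2 *.
rewrite -jacobian_comp // -(jacobian_id (coord c p)).
apply: near_eq_jacobian; last exact: differentiable_comp.
have : nbhs p (dom c') by apply: open_nbhs_nbhs; split => //; exact: dom_open.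
move=> /(near_coord cp); apply: filterS => _ [q [cq cq' <-]].
by rewrite /local_map /= coordK // coordK // coordK.
Qed.

Lemma transition_jacobian_unit (c c' : chart M) p : dom c p -> dom c' p ->
  'J (local_map idfun c c') (coord c p) \in unitmx.
Proof.
by move=> cp cp'; exact: (proj1 (mulmx1_unit (transition_jacobianK cp cp'))).
Qed.

End Chart.

Section Forms.
Variables (R : realType) (m : nat) (M : manifold R m).

Section Ext.
Variables (k : nat) (w : tfield M k).
Hypothesis wf : is_form w.

Lemma form_multilinear c x : cod c x -> multilinear (w c x).
Proof. by case: wf => -[H _ _] _; exact: H. Qed.

Lemma form_alternating c x : cod c x -> alternating (w c x).
Proof. by case: wf => _; apply. Qed.

Lemma form_smooth c V : smooth_on (fun x => w c x V) (cod c).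
Proof. by case: wf => -[_ H _] _; exact: H. Qed.

Lemma form_differentiable c x V : cod c x -> differentiable (fun y => w c y V) x.
Proof. exact: smooth_on_differentiable (form_smooth c V). Qed.

Lemma form_is_derive c x V v : cod c x ->
  is_derive x v (fun y => w c y V) ('D_v (fun y => w c y V) x).
Proof.
move=> cx; apply: derivableP; apply: diff_derivable.
exact: form_differentiable.
Qed.

Lemma near_form_multilinear c x : cod c x ->
  \forall y \near x, multilinear (w c y).
Proof. by move=> /near_cod; apply: filterS => y; exact: form_multilinear. Qed.

(** Terms deleting a row other than [i] and [j] still see two equal rows. The two left differentiate
    along the same vector, and their sum is the derivative of a function that vanishes near [x]. *)
Lemma ext_d_alternating c x : cod c x -> alternating (ext_d w c x).
Proof.
move=> cx V i j ij rij; rewrite /ext_d (bigD1 i) //= (bigD1 j) 1?eq_sym //=.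
rewrite [X in _ + (_ + X)]big1 ?addr0; last first.
  move=> r /andP[ri rj].
  have near0 : \forall y \near x, cst 0 y = w c y (row' r V).
    apply: filterS (near_cod cx) => y cy; apply/esym.
    have [i' iE _] := unlift_some ri; have [j' jE _] := unlift_some rj.
    apply: (form_alternating cy (i := i') (j := j')).
      by apply: contra ij => /eqP e; rewrite iE jE e.
    by rewrite !row_row' -iE -jE.
  apply: etrans (congr1 (fun z => (-1) ^+ r * z)
    (etrans (esym (near_eq_derive (row r V) near0)) (derive_cst _ _ _))) _.
  by rewrite mulr0.
have near0 : \forall y \near x, cst 0 y =
    (-1) ^+ i * w c y (row' i V) + (-1) ^+ j * w c y (row' j V).
  apply: filterS (near_cod cx) => y cy; apply/esym.
  exact: alternating_row' (form_multilinear cy) (form_alternating cy) ij rij.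
have D1 (r : 'I_k.+1) : is_derive x (row r V) (fun y => (-1) ^+ r * w c y (row' r V))
   (0 * w c x (row' r V) + (-1) ^+ r * 'D_(row r V) (fun y => w c y (row' r V)) x).
  exact: is_derive_mulf (is_derive_cst ((-1) ^+ r : R) _ _) (form_is_derive _ _ cx).
have Di := D1 i; have Dj := D1 j; rewrite -rij in Dj *.
rewrite !mul0r !add0r in Di Dj.
have E := is_derive_E (is_derive_addf Di Dj); apply: etrans (esym E) _.
apply: etrans (esym (near_eq_derive (row i V) near0)) _; exact: derive_cst.
Qed.

Lemma ext_d_multilinear c x : cod c x -> multilinear (ext_d w c x).
Proof.
move=> cx i a u v V; rewrite /ext_d mulr_sumr -big_split; apply: eq_bigr => r _ /=.
have [{i}->|ri] := eqVneq i r.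
  rewrite !row'_set_row !row_set_row eqxx.
  have L (z : 'rV[R]_m) := deriveE z (form_differentiable (row' r V) cx).
  rewrite !L linearP /= mulrDr; congr (_ + _).
  by rewrite -[a *: _]/(a * _) mulrCA.
rewrite !row_set_row eq_sym (negPf ri).
have [i' iE _] : {i' | i = lift r i' & unlift r i = Some i'}.
  by apply: unlift_some; rewrite eq_sym.
rewrite iE !row'_set_row_lift.
have near_lin : \forall y \near x,
    a * w c y (set_row i' u (row' r V)) + w c y (set_row i' v (row' r V)) =
    w c y (set_row i' (a *: u + v) (row' r V)).
  by apply: filterS (near_cod cx) => y cy; rewrite (form_multilinear cy).
have D := is_derive_addf (is_derive_mulf (is_derive_cst (a : R) x (row r V))
   (form_is_derive (set_row i' u (row' r V)) (row r V) cx))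
   (form_is_derive (set_row i' v (row' r V)) (row r V) cx).
have E := is_derive_E (near_eq_is_derive near_lin D).
by rewrite E mul0r add0r mulrDr mulrCA.
Qed.

Lemma ext_d_smooth c V : smooth_on (fun x => ext_d w c x V) (cod c).
Proof.
have oc := @cod_open R m M c; apply: smooth_on_sum => // i r.
apply: Ck_onM => //; first exact: Ck_on_cst.
exact: (smooth_on_derive (row i V) (form_smooth c (row' i V))).
Qed.

(** Differentiating the transformation law of [w] yields the desired term plus one with second
    derivatives of the transition map; the latter is removed by [symmetric_sum0]. *)
Lemma ext_d_transition c c' (p : M) : dom c p -> dom c' p -> forall V,
  ext_d w c (coord c p) V =
  ext_d w c' (coord c' p) (V *m 'J (local_map idfun c c') (coord c p)).
Proof.
move=> cp cp' V; set t := local_map idfun c c'; set x := coord c p.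
set J := 'J t x.
have tx : t x = coord c' p by rewrite /t /x local_mapE.
have dt : differentiable t x by exact: transition_differentiable.
have cx' : cod c' (t x) by rewrite tx; exact: cod_coord.
pose O := coord c @` (dom c `&` dom c').
have oO : open O by apply: open_coord; exact: dom_open.
have Ox : O x by exists p.
have ts : smooth_on t O by exact: transition_smooth.
have DJ y v : O y -> 'D_v t y = v *m 'J t y.
  by move=> Oy; exact: deriveEjacobian (smooth_on_differentiable ts Oy).
have wE (A : 'M[R]_(k, m)) : \forall y \near x, w c' (t y) (A *m 'J t y) = w c y A.
  have : \forall y \near x, O y by exact: open_nbhs_nbhs.
  apply: filterS => y [q [cq cq'] <-]; rewrite /t local_mapE //.
  by case: wf => -[_ _ tr] _; rewrite (tr c c').
have key (A : 'M[R]_(k, m)) v : 'D_v (fun y => w c y A) x =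
    'D_(v *m J) (fun z => w c' z (A *m J)) (t x) +
    \sum_(r < k) w c' (t x)
       (set_row r ('D_v (fun y => 'D_(row r A) t y) x) (A *m J)).
  (* Row [a] is the second derivative of [t] along [row a A] and [v]: the rate at which the
     transported argument turns. *)
  pose N : 'M[R]_(k, m) := \matrix_(a, b) ('D_v (fun y => 'D_(row a A) t y) x) 0 b.
  have rN a : row a N = 'D_v (fun y => 'D_(row a A) t y) x.
    by apply/rowP => b; rewrite mxE mxE.
  have dM i j : is_derive x v (fun y => (A *m 'J t y) i j) (N i j).
    have dD : differentiable (fun y => 'D_(row i A) t y) x.
      exact: smooth_on_differentiable (smooth_on_derive _ ts) Ox.
    have near1 : \forall y \near x, ('D_(row i A) t y) 0 j = (A *m 'J t y) i j.
      have : \forall y \near x, O y by exact: open_nbhs_nbhs.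
      by apply: filterS => y Oy; rewrite DJ // -row_mul mxE.
    apply: (near_eq_is_derive near1).
    have -> : N i j = ('D_v (fun y => 'D_(row i A) t y) x) 0 j by exact: mxE.
    exact: is_derive_coord.
  have D := is_derive_tensor dt (near_form_multilinear cx')
    (fun A => form_differentiable A cx') dM.
  have E := is_derive_E (near_eq_is_derive (wE A) D).
  apply: etrans E _; rewrite DJ // -/J; congr (_ + _).
  by apply: eq_bigr => r _; rewrite rN.
rewrite /ext_d -tx.
under eq_bigr do rewrite key mulrDr.
rewrite big_split /=.
have S0 := symmetric_sum0 (w := w c' (t x)) (V *m J)
  (h := fun i j => 'D_(row i V) (fun y => 'D_(row j V) t y) x)
  (form_multilinear cx') (form_alternating cx')
  (fun i j => smooth_derive_sym_rV _ _ oO ts Ox).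
rewrite [X in _ + X](_ : _ = 0).
  rewrite addr0; apply: eq_bigr => i _.
  by rewrite row_mul row'_mulmx.
rewrite -[RHS]S0; apply: eq_bigr => i _; congr (_ * _).
by apply: eq_bigr => r _; rewrite row_row' row'_mulmx.
Qed.

Lemma is_form_ext_d : is_form (ext_d w).
Proof.
split; last by move=> c x cx; exact: ext_d_alternating.
split.
- by move=> c x cx; exact: ext_d_multilinear.
- exact: ext_d_smooth.
- exact: ext_d_transition.
Qed.

(** By [key], differentiating [lie X w] gives mixed derivatives of [w], which commute; second
    derivatives of [X], killed by [symmetric_sum0]; and terms with one derivative of [X] and one of
    [w], which [sum_diag_lift] matches with those on the left. *)
Lemma lie_ext_d (X : vfield M) c x V : smooth_on (X c) (cod c) -> cod c x ->
  lie X (ext_d w) c x V = ext_d (lie X w) c x V.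
Proof.
move=> Xs cx; have oc := @cod_open R m M c.
have dX : differentiable (X c) x by exact: smooth_on_differentiable Xs cx.
have key v (A : 'M[R]_(k, m)) : 'D_v (fun y => lie X w c y A) x =
   ('D_(X c x) (fun y => 'D_v (fun z => w c z A) y) x +
    'D_('D_v (X c) x) (fun z => w c z A) x) +
   (\sum_(r < k) 'D_v (fun y => w c y (set_row r ('D_(row r A) (X c) x) A)) x +
    \sum_(r < k) w c x (set_row r ('D_v (fun y => 'D_(row r A) (X c) y) x) A)).
  have D1 : is_derive x v (fun y => 'D_(X c y) (fun z => w c z A) y)
     ('D_v (fun y => 'D_(X c x) (fun z => w c z A) y) x +
      'D_('D_v (X c) x) (fun z => w c z A) x).
    (* A directional derivative is linear in its direction, so the moving direction [X c y] is
       treated as the argument of a tensor of degree one. *)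
    have Tl : \forall y \near x,
        multilinear (fun u : 'M[R]_(1, m) => 'D_u (fun z => w c z A) y).
      apply: filterS (near_cod cx) => y cy i a u u' V'.
      have L (z : 'rV[R]_m) := deriveE z (form_differentiable A cy).
      by rewrite !set_row1 !L linearP.
    have dT (u : 'M[R]_(1, m)) : differentiable (fun y => 'D_u (fun z => w c z A) y) x.
      exact: smooth_on_differentiable (smooth_on_derive u (form_smooth c A)) cx.
    have dM (i : 'I_1) j : is_derive x v (fun y => X c y i j) (('D_v (X c) x) i j).
      exact: is_derive_coord.
    have D := is_derive_tensor_id Tl dT dM.
    by rewrite big_ord1 set_row1 row_id in D.
  have D2 r : is_derive x v (fun y => w c y (set_row r ('D_(row r A) (X c) y) A))
     ('D_v (fun y => w c y (set_row r ('D_(row r A) (X c) x) A)) x +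
      w c x (set_row r ('D_v (fun y => 'D_(row r A) (X c) y) x) A)).
    pose N : 'M[R]_(k, m) := set_row r ('D_v (fun y => 'D_(row r A) (X c) y) x) 0.
    have dM i j : is_derive x v (fun y => set_row r ('D_(row r A) (X c) y) A i j) (N i j).
      have dD : differentiable (fun y => 'D_(row r A) (X c) y) x.
        exact: smooth_on_differentiable (smooth_on_derive _ Xs) cx.
      rewrite /N set_rowE; under eq_fun do rewrite set_rowE.
      case: eqP => _; last by rewrite mxE; exact: is_derive_cst.
      exact: is_derive_coord.
    have D := is_derive_tensor_id (near_form_multilinear cx)
      (fun A => form_differentiable A cx) dM.
    apply: (is_derive_eq D); congr (_ + _).
    rewrite (bigD1 r) //= big1 ?addr0 => [|i ir].
      by rewrite row_set_row eqxx set_row_set_row.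
    rewrite row_set_row (negPf ir) row0; apply: multilinear0.
    exact: form_multilinear.
  have E := is_derive_E (is_derive_addf D1 (is_derive_sumf D2)).
  rewrite /lie E big_split.
  exact: (congr1 (fun z => z + _ + _) (smooth_derive_sym _ _ oc (form_smooth c A) cx)).
have wl := form_multilinear cx; have wa := form_alternating cx.
rewrite [RHS]/ext_d.
under [RHS]eq_bigr do rewrite key !mulrDr.
have S0 := symmetric_sum0 (w := w c x) V
  (h := fun i j => 'D_(row i V) (fun y => 'D_(row j V) (X c) y) x)
  wl wa (fun i j => smooth_derive_sym_rV _ _ oc Xs cx).
rewrite !big_split /= [X in _ + (_ + X)](_ : _ = 0); last first.
  apply: etrans S0; apply: eq_bigr => i _.
  apply: (congr1 (fun z => (-1) ^+ i * z)); apply: eq_bigr => r _.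
  exact: (congr1 (fun u => w c x (set_row r
    ('D_(row i V) (fun y => 'D_u (X c) y) x) (row' i V))) (row_row' i r V)).
rewrite addr0 -addrA; rewrite /lie; congr (_ + _).
  have D (i : 'I_k.+1) : is_derive x (X c x)
      (fun y => (-1) ^+ i * 'D_(row i V) (fun z => w c z (row' i V)) y)
      (0 * 'D_(row i V) (fun z => w c z (row' i V)) x + (-1) ^+ i *
        'D_(X c x) (fun y => 'D_(row i V) (fun z => w c z (row' i V)) y) x).
    have dD : differentiable (fun y => 'D_(row i V) (fun z => w c z (row' i V)) y) x.
      exact: smooth_on_differentiable (smooth_on_derive _ (form_smooth c _)) cx.
    exact: is_derive_mulf (is_derive_cst ((-1) ^+ i : R) _ _)
      (derivableP (diff_derivable dD)).
  have E := is_derive_E (is_derive_sumf D); apply: etrans E _.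
  by apply: eq_bigr => i _; rewrite mul0r add0r.
apply: (sum_diag_lift (fun i => (-1) ^+ i)
  (F := fun i j => 'D_(row i (set_row j ('D_(row j V) (X c) x) V))
    (fun y => w c y (row' i (set_row j ('D_(row j V) (X c) x) V))) x)
  (A := fun i => 'D_('D_(row i V) (X c) x) (fun y => w c y (row' i V)) x)
  (B := fun i r => 'D_(row i V)
    (fun y => w c y (set_row r ('D_(row r (row' i V)) (X c) x) (row' i V))) x)).
  by move=> i; rewrite row_set_row eqxx row'_set_row.
by move=> i r; rewrite row_set_row (negPf (neq_lift _ _)) row'_set_row_lift row_row'.
Qed.

Lemma homogeneous_ext_d (X : vfield M) lambda : (forall c, smooth_on (X c) (cod c)) ->
  homogeneous X lambda w -> homogeneous X lambda (ext_d w).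
Proof.
move=> Xs hw c x cx V; rewrite lie_ext_d // /ext_d mulr_sumr.
apply: eq_bigr => i _.
have near1 : \forall y \near x, lambda * w c y (row' i V) = lie X w c y (row' i V).
  by apply: filterS (near_cod cx) => y cy; rewrite (hw c y cy).
have E := is_derive_E (near_eq_is_derive near1 (is_derive_mulf
  (is_derive_cst (lambda : R) x (row i V)) (form_is_derive (row' i V) (row i V) cx))).
by rewrite E mul0r add0r mulrCA.
Qed.

End Ext.
End Forms.

(** * The Hodge star of a pseudo-Riemannian manifold *)

Section FunctionAlgebra.
Variables (R : realType) (T : Type) (P : (T -> R) -> Prop).
Hypothesis Pc : forall a, P (fun=> a).
Hypothesis Pd : forall f g, P f -> P g -> P (fun t => f t + g t).
Hypothesis Pm : forall f g, P f -> P g -> P (fun t => f t * g t).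

Lemma falg_prod (I : finType) (f : I -> T -> R) :
  (forall i, P (f i)) -> P (fun t => \prod_i f i t).
Proof.
move=> Pf; have -> : (fun t => \prod_i f i t) = \prod_i f i.
  by apply/funext => t; rewrite fct_prodE.
elim/big_rec: _ => [|i g _ Pg]; first exact: Pc.
exact: Pm.
Qed.

Lemma falg_sum (I : finType) (f : I -> T -> R) :
  (forall i, P (f i)) -> P (fun t => \sum_i f i t).
Proof.
move=> Pf; have -> : (fun t => \sum_i f i t) = \sum_i f i.
  by apply/funext => t; rewrite fct_sumE.
elim/big_rec: _ => [|i g _ Pg]; first exact: Pc.
exact: Pd.
Qed.

Lemma falg_det n (A : T -> 'M[R]_n) :
  (forall i j, P (fun t => A t i j)) -> P (fun t => \det (A t)).
Proof.
move=> PA; apply: falg_sum => s; apply: Pm; first exact: Pc.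
by apply: falg_prod => i.
Qed.

Lemma falg_adj n (A : T -> 'M[R]_n) i j :
  (forall i j, P (fun t => A t i j)) -> P (fun t => (\adj (A t)) i j).
Proof.
move=> PA; under eq_fun do rewrite mxE /cofactor.
apply: Pm; first exact: Pc.
by apply: falg_det => a b; under eq_fun do rewrite !mxE.
Qed.

Variable L : (T -> R) -> Prop.
Hypothesis L0 : L (fun=> 0).
Hypothesis Ld : forall f g, L f -> L g -> L (fun t => f t + g t).
Hypothesis Lm : forall f g, P f -> L g -> L (fun t => f t * g t).

Lemma fmod_sum (I : finType) (f : I -> T -> R) :
  (forall i, L (f i)) -> L (fun t => \sum_i f i t).
Proof.
move=> Lf; have -> : (fun t => \sum_i f i t) = \sum_i f i.
  by apply/funext => t; rewrite fct_sumE.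
by elim/big_rec: _ => [//|i g _ Lg]; exact: Ld.
Qed.

(** [P] is an algebra of functions and [L] a module over it. For smoothness both are the functions
    of class [r]; for the weight, [P] is the functions stationary at [0] and [L] those whose
    derivative there is [lambda] times their value. *)
Lemma fmod_star m k l (A : T -> 'M[R]_m) (c : T -> R)
    (xi : T -> 'M[R]_(k, m) -> R) (W : 'M[R]_(l, m)) :
  (forall i j, P (fun t => A t i j)) -> P (fun t => (\det (A t))^-1) -> P c ->
  (forall V, L (fun t => xi t V)) ->
  L (fun t => star_covector ((\det (A t))^-1 *: \adj (A t)) (c t) (xi t) W).
Proof.
move=> PA Pdet Pcc Lxi; apply: Lm; first exact: Pc.
apply: fmod_sum => i; apply: fmod_sum => j; apply: Lm.
  apply: falg_prod => r; under eq_fun do rewrite mxE.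
  by apply: Pm => //; exact: falg_adj.
apply: Lm; last exact: Lxi.
by apply: Pm => //; exact: Pc.
Qed.

End FunctionAlgebra.

Section Gram.
Variables (R : realType) (m : nat).

Lemma multilinear2_expand (T : 'M[R]_(2, m) -> R) (u v : 'rV[R]_m) : multilinear T ->
  T (col_mx u v : 'M[R]_(1 + 1, m)) =
  \sum_a \sum_b u 0 a * T (col_mx (delta_mx 0 a : 'rV[R]_m) (delta_mx 0 b : 'rV[R]_m)) * v 0 b.
Proof.
move=> Tl.
have T1 (w z : 'rV[R]_m) : T (col_mx w z) =
    \sum_a w 0 a * T (col_mx (delta_mx 0 a : 'rV[R]_m) z).
  have -> : col_mx w z = @set_row R (1 + 1) m (lshift 1 ord0)
      (\sum_a w 0 a *: (delta_mx 0 a : 'rV[R]_m)) (col_mx w z).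
    by rewrite -row_sum_delta (set_row_col_mxu ord0 w w z) set_row1.
  rewrite (multilinear_sum _ _ _ Tl); apply: eq_bigr => a _.
  by rewrite (multilinearZ _ _ _ _ Tl) (set_row_col_mxu ord0 _ w z) set_row1.
have T2 (w z : 'rV[R]_m) : T (col_mx w z) =
    \sum_a z 0 a * T (col_mx w (delta_mx 0 a : 'rV[R]_m)).
  have -> : col_mx w z = @set_row R (1 + 1) m (rshift 1 ord0)
      (\sum_a z 0 a *: (delta_mx 0 a : 'rV[R]_m)) (col_mx w z).
    by rewrite -row_sum_delta (set_row_col_mxd ord0 z w z) set_row1.
  rewrite (multilinear_sum _ _ _ Tl); apply: eq_bigr => a _.
  by rewrite (multilinearZ _ _ _ _ Tl) (set_row_col_mxd ord0 _ w z) set_row1.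
rewrite T1; apply: eq_bigr => a _; rewrite T2 mulr_sumr; apply: eq_bigr => b _.
by rewrite mulrA mulrAC.
Qed.

Lemma gram_mul (T : 'M[R]_(2, m) -> R) (B : 'M[R]_m) : multilinear T ->
  \matrix_(i < m, j < m)
    T ((col_mx (delta_mx 0 i : 'rV[R]_m) (delta_mx 0 j : 'rV[R]_m) : 'M[R]_(1 + 1, m)) *m B) =
  B *m (\matrix_(i < m, j < m)
    T (col_mx (delta_mx 0 i : 'rV[R]_m) (delta_mx 0 j : 'rV[R]_m))) *m B^T.
Proof.
move=> Tl; apply/matrixP => i j.
rewrite [LHS]mxE mul_col_mx (multilinear2_expand _ _ Tl) [RHS]mxE exchange_big /=.
apply: eq_bigr => b _; rewrite [in RHS]mxE mulr_suml; apply: eq_bigr => a _.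
by rewrite -!rowE !mxE.
Qed.

End Gram.

Lemma near_sg (R : realType) (T : topologicalType) (f : T -> R) x :
  {for x, continuous f} -> f x != 0 ->
  \forall y \near x, Num.sg (f y) = Num.sg (f x).
Proof.
move=> fc; rewrite neq_lt => /orP[h|h].
  have : \forall y \near x, f y < 0 by exact: (cvgr_lt _ fc).
  by apply: filterS => y fy; rewrite !ltr0_sg.
have : \forall y \near x, 0 < f y by exact: (cvgr_gt _ fc).
by apply: filterS => y fy; rewrite !gtr0_sg.
Qed.

(** * Curves stationary at [0], and curves whose derivative there is [lambda] times their value *)

Section ZeroDerivative.
Variable R : realType.
Implicit Types f g : R -> R.

Lemma derive0_cst (a : R) : is_derive (0 : R) (1 : R) (fun=> a) 0.
Proof. exact: is_derive_cst. Qed.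

Lemma derive0D f g : is_derive (0 : R) (1 : R) f 0 -> is_derive (0 : R) (1 : R) g 0 ->
  is_derive (0 : R) (1 : R) (fun t => f t + g t) 0.
Proof. by move=> hf hg; apply: (is_derive_eq (is_derive_addf hf hg)); rewrite addr0. Qed.

Lemma derive0M f g : is_derive (0 : R) (1 : R) f 0 -> is_derive (0 : R) (1 : R) g 0 ->
  is_derive (0 : R) (1 : R) (fun t => f t * g t) 0.
Proof.
by move=> hf hg; apply: (is_derive_eq (is_derive_mulf hf hg)); rewrite mul0r mulr0 addr0.
Qed.

Lemma derive0V f : f 0 != 0 -> is_derive (0 : R) (1 : R) f 0 ->
  is_derive (0 : R) (1 : R) (fun t => (f t)^-1) 0.
Proof.
move=> f0 hf; have df : derivable f 0 1 by case: hf.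
apply: DeriveDef; first exact: derivableV.
by rewrite deriveV // (is_derive_E hf) scaler0.
Qed.

Lemma derive0_sqrt f : 0 < f 0 -> is_derive (0 : R) (1 : R) f 0 ->
  is_derive (0 : R) (1 : R) (fun t => Num.sqrt (f t)) 0.
Proof.
move=> f0 hf; have D := is_derive1_comp (is_derive1_sqrt f0) hf.
by apply: (is_derive_eq D); rewrite mulr0.
Qed.

Lemma derive_eigenD lambda f g :
  is_derive (0 : R) (1 : R) f (lambda * f 0) ->
  is_derive (0 : R) (1 : R) g (lambda * g 0) ->
  is_derive (0 : R) (1 : R) (fun t => f t + g t) (lambda * (f 0 + g 0)).
Proof. by move=> hf hg; apply: (is_derive_eq (is_derive_addf hf hg)); rewrite mulrDr. Qed.

Lemma derive_eigenM lambda f g :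
  is_derive (0 : R) (1 : R) f 0 -> is_derive (0 : R) (1 : R) g (lambda * g 0) ->
  is_derive (0 : R) (1 : R) (fun t => f t * g t) (lambda * (f 0 * g 0)).
Proof.
move=> hf hg; apply: (is_derive_eq (is_derive_mulf hf hg)).
by rewrite mul0r add0r mulrCA.
Qed.

End ZeroDerivative.

Lemma is_derive_ray (R : realType) (V : normedModType R) (u x : V) :
  is_derive (0 : R) (1 : R) (fun s : R => s *: u + x) u.
Proof.
have D : is_derive (0 : R) (1 : R) (fun t : R => idfun (t *: u + x))
    ('D_u idfun (0 *: u + x)).
  by apply: is_derive_line; exact: derivable_id.
by apply: (is_derive_eq D); exact: derive_id.
Qed.

Section TensorCurve.
Variables (R : realType) (m k : nat) (M : manifold R m) (T : tfield M k).
Hypothesis Tt : is_tensor T.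

Lemma tensor_near_multilinear c x : cod c x -> \forall y \near x, multilinear (T c y).
Proof. by case: Tt => H _ _ /near_cod; apply: filterS => y; exact: H. Qed.

Lemma tensor_differentiable c x V : cod c x -> differentiable (fun y => T c y V) x.
Proof. by case: Tt => _ H _; exact: smooth_on_differentiable (H c V). Qed.

(* To first order in [s] the flow of [X] is [x |-> x + s X(x)], with differential
   [1 + s DX]. *)
Lemma lie_curve (X : vfield M) c x V : cod c x -> differentiable (X c) x ->
  is_derive (0 : R) (1 : R)
    (fun s : R => T c (s *: X c x + x) (V *m (1%:M + s *: 'J (X c) x)))
    (lie X T c x V).
Proof.
move=> cx dX; set A := 'J (X c) x.
pose g (s : R) : 'rV[R]_m := s *: X c x + x.
have g0 : g 0 = x by rewrite /g scale0r add0r.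
have dgl : is_derive (0 : R) (1 : R) g (X c x) by exact: is_derive_ray.
have dg : differentiable g 0 by apply/derivable1_diffP; case: dgl.
have dM i j : is_derive (0 : R) (1 : R)
    (fun s : R => (V *m (1%:M + s *: A)) i j) ((V *m A) i j).
  have E : (fun s : R => (V *m (1%:M + s *: A)) i j) =
      fun s : R => V i j + s * (V *m A) i j.
    by apply/funext => s; rewrite mulmxDr mulmx1 -scalemxAr mxE [X in _ + X]mxE.
  rewrite E.
  have D := is_derive_addf (is_derive_cst (V i j : R) (0 : R) (1 : R))
    (is_derive_mulf (is_derive_id (0 : R) (1 : R))
      (is_derive_cst ((V *m A) i j : R) (0 : R) (1 : R))).
  by apply: (is_derive_eq D); rewrite add0r mul1r mulr0 addr0.
have T1 : \forall z \near g 0, multilinear (T c z).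
  by rewrite g0; exact: tensor_near_multilinear.
have T2 B : differentiable (fun z => T c z B) (g 0).
  by rewrite g0; exact: tensor_differentiable.
have D := is_derive_tensor dg T1 T2 dM.
apply: (is_derive_eq D); rewrite (is_derive_E dgl) g0 scale0r addr0 mulmx1.
rewrite /lie; apply: (congr1 (fun z => _ + z)); apply: eq_bigr => i _.
by rewrite row_mul -(deriveEjacobian _ dX).
Qed.

End TensorCurve.

Section Hodge.
Variables (R : realType) (m : nat) (M : manifold R m) (G : tfield M 2).
Variable sgn : chart M -> 'rV[R]_m -> R.
Hypothesis Gt : is_tensor G.
Hypothesis Gu : forall c x, cod c x -> gram G c x \in unitmx.
(** The orientation enters only through this and the next property: local constancy lets the density
    be differentiated, and the transition rule makes the star independent of the chart. *)
Hypothesis sgn_near : forall c x, cod c x -> \forall y \near x, sgn c y = sgn c x.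
Hypothesis sgn_trans : forall c c' p, dom c p -> dom c' p ->
  sgn c (coord c p) = sgn c' (coord c' p) *
    Num.sg (\det ('J (local_map idfun c c') (coord c p))).

Let vol c x := sgn c x * Num.sqrt `|\det (gram G c x)|.

Lemma hodgeE k l (xi : tfield M k) c x : (k + l)%N = m ->
  hodge G sgn (l := l) xi c x =
  star_covector (invmx (gram G c x)) (vol c x) (xi c x).
Proof. exact: hodge_covectorE. Qed.

Lemma gram_pull c x (B : 'M[R]_m) : cod c x ->
  \matrix_(i < m, j < m)
    G c x ((col_mx (delta_mx 0 i : 'rV[R]_m) (delta_mx 0 j : 'rV[R]_m) : 'M[R]_(1 + 1, m)) *m B)
  = B *m gram G c x *m B^T.
Proof. by move=> cx; apply: gram_mul; case: Gt => H _ _; exact: H. Qed.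

(** The square root contributes [|\det B|], and the sign of [\det B] restores the signed
    determinant. *)
Lemma volume_pull (s : R) (A B : 'M[R]_m) :
  s * Num.sg (\det B) * Num.sqrt `|\det (B *m A *m B^T)| =
  s * Num.sqrt `|\det A| * \det B.
Proof.
rewrite !det_mulmx det_tr; move: (\det A) (\det B) => a b.
have -> : b * a * b = b ^+ 2 * a by rewrite expr2 mulrAC.
rewrite normrM normrX sqrtrM ?exprn_ge0 // sqrtr_sqr normr_id.
rewrite [X in _ = _ * X](numEsg b); ring.
Qed.

Section Star.
Variables (k l : nat) (xi : tfield M k).
Hypothesis kl : (k + l)%N = m.
Hypothesis xit : is_tensor xi.

Lemma hodge_transition c c' p : dom c p -> dom c' p -> forall W,
  hodge G sgn (l := l) xi c (coord c p) W =
  hodge G sgn (l := l) xi c' (coord c' p)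
    (W *m 'J (local_map idfun c c') (coord c p)).
Proof.
move=> cp cp' W; rewrite !hodgeE //.
set B := 'J _ _; set x := coord c p; set x' := coord c' p.
have Bu : B \in unitmx by exact: transition_jacobian_unit.
have cx' : cod c' x' by exact: cod_coord.
have gE : gram G c x = B *m gram G c' x' *m B^T.
  rewrite -gram_pull //; apply/matrixP => i j; rewrite !mxE.
  by case: Gt => _ _ tr; rewrite (tr c c').
have xiE : xi c x = fun V => xi c' x' (V *m B).
  by apply/funext => V; case: xit => _ _ tr; rewrite (tr c c').
rewrite /vol (sgn_trans cp cp') -/B -/x -/x' gE volume_pull xiE.
apply: star_covector_mul => //; last exact: Gu.
by case: xit => H _ _; exact: H.
Qed.

Lemma hodge_smooth c W : smooth_on (fun x => hodge G sgn (l := l) xi c x W) (cod c).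
Proof.
have oc := @cod_open R m M c.
have Gs i j : smooth_on (fun x => gram G c x i j) (cod c).
  case: Gt => _ H _ r.
  by apply: Ck_on_ext oc _ (H c _ r) => x _; rewrite mxE.
have ds : smooth_on (fun x => \det (gram G c x)) (cod c).
  move=> r; apply: (falg_det (P := fun f => Ck_on r f (cod c))).
  - by move=> a; exact: Ck_on_cst.
  - by move=> f g; exact: Ck_onD.
  - by move=> f g; exact: Ck_onM.
  - by move=> i j; exact: Gs.
have d0 x : cod c x -> \det (gram G c x) != 0.
  by move=> /Gu; rewrite unitmxE unitfE.
have vs : smooth_on (vol c) (cod c).
  (* Near a point both the orientation sign and the sign of the Gram determinant are frozen, so the
     absolute value becomes multiplication by a constant and the square root has a positive
     argument. *)
  move=> r; apply: Ck_on_local => x cx.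
  have dc : {for x, continuous (fun y => \det (gram G c y))} by exact: (ds 0%N x cx).
  have : nbhs x [set y | cod c y /\ (sgn c y = sgn c x /\
      Num.sg (\det (gram G c y)) = Num.sg (\det (gram G c x)))].
    exact: filterI (near_cod cx) (filterI (sgn_near cx) (near_sg dc (d0 x cx))).
  rewrite nbhsE => -[U' [oU' U'x] sU']; exists U' => //.
  apply: (Ck_on_ext (f := fun y => sgn c x *
    Num.sqrt (Num.sg (\det (gram G c x)) * \det (gram G c y)))) => //.
    by move=> y /sU'[_ [sy dy]]; rewrite /vol sy normrEsg dy.
  apply: Ck_onM => //; first exact: Ck_on_cst.
  apply: Ck_on_sqrt => //.
    by move=> y /sU'[cy [_ <-]]; rewrite -normrEsg normr_gt0 d0.
  apply: Ck_onM => //; first exact: Ck_on_cst.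
  by apply: Ck_on_subset (ds r) => y /sU'[].
move=> r.
apply: (Ck_on_ext (f := fun x => star_covector
   ((\det (gram G c x))^-1 *: \adj (gram G c x)) (vol c x) (xi c x) W)) => //.
  by move=> x cx; rewrite hodgeE // /invmx Gu.
apply: (@fmod_star R _ (fun f => Ck_on r f (cod c)) _ _ _ (fun f => Ck_on r f (cod c))).
- by move=> a; exact: Ck_on_cst.
- by move=> f g; exact: Ck_onD.
- by move=> f g; exact: Ck_onM.
- exact: Ck_on_cst.
- by move=> f g; exact: Ck_onD.
- by move=> f g; exact: Ck_onM.
- by move=> i j; exact: Gs.
- exact: Ck_onV.
- exact: vs.
- by move=> V; case: xit => _ H _; exact: H.
Qed.

Lemma is_form_hodge : is_form (hodge G sgn (l := l) xi).
Proof.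
have P c x := star_covectorP (invmx (gram G c x)) (vol c x) (xi c x) kl.
split; last first.
  by move=> c x cx; rewrite hodgeE //; case: (P c x).
split.
- by move=> c x cx; rewrite hodgeE //; case: (P c x).
- exact: hodge_smooth.
- exact: hodge_transition.
Qed.

Lemma homogeneous_hodge (X : vfield M) lambda :
  (forall c, smooth_on (X c) (cod c)) ->
  tfield_eq (lie X G) (fun c x V => 0) ->
  homogeneous X lambda xi -> homogeneous X lambda (hodge G sgn (l := l) xi).
Proof.
move=> Xs XG Xxi c x cx W.
have dX : differentiable (X c) x by exact: smooth_on_differentiable (Xs c) cx.
have [sst _] := is_form_hodge.
have D1 := lie_curve sst W cx dX.
set A := 'J (X c) x in D1.
pose g (s : R) := s *: X c x + x.
pose B (s : R) : 'M[R]_m := 1%:M + s *: A.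
(* [xis], [Gs] and [vs] are the form, the Gram matrix and the density at [g s], pulled back to [x]
   by [B s]. *)
pose xis (s : R) V := xi c (g s) (V *m B s).
pose Gs (s : R) : 'M[R]_m := B s *m gram G c (g s) *m (B s)^T.
pose vs (s : R) := sgn c x * Num.sqrt `|\det (Gs s)|.
have g0 : g 0 = x by rewrite /g scale0r add0r.
have B0 : B 0 = 1%:M by rewrite /B scale0r addr0.
have dg : {for 0, continuous g}.
  apply: differentiable_continuous; apply/derivable1_diffP.
  by case: (is_derive_ray (X c x) x).
have near_g : \forall s \near (0 : R), cod c (g s) /\ sgn c (g s) = sgn c x.
  have gc : g s @[s --> (0 : R)] --> g 0 by exact: dg.
  rewrite g0 in gc; exact: (gc _ (filterI (near_cod cx) (sgn_near cx))).
have dB i j : is_derive (0 : R) (1 : R) (fun s => B s i j) (A i j).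
  have E : (fun s => B s i j) = fun s => (1%:M : 'M[R]_m) i j + s * A i j.
    by apply/funext => s; rewrite /B mxE [X in _ + X]mxE.
  rewrite E.
  have D := is_derive_addf
    (is_derive_cst ((1%:M : 'M[R]_m) i j : R) (0 : R) (1 : R))
    (is_derive_mulf (is_derive_id (0 : R) (1 : R))
      (is_derive_cst (A i j : R) (0 : R) (1 : R))).
  by apply: (is_derive_eq D); rewrite add0r mul1r mulr0 addr0.
(* Positivity makes [B s] invertible and keeps the orientation, so no sign enters the pulled-back
   density. *)
have near_B : \forall s \near (0 : R), 0 < \det (B s).
  have dc : {for (0 : R), continuous (fun s => \det (B s))}.
    apply: (falg_det (P := fun f => {for (0 : R), continuous f})).
    - by move=> a; exact: cst_continuous.
    - by move=> f1 f2 h1 h2; exact: continuousD.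
    - by move=> f1 f2 h1 h2; exact: continuousM.
    - move=> i j; apply: differentiable_continuous; apply/derivable1_diffP.
      by case: (dB i j).
  by apply: (cvgr_gt _ dc); rewrite B0 det1.
have GsE i j : \forall s \near (0 : R), G c (s *: X c x + x)
     ((col_mx (delta_mx 0 i : 'rV[R]_m) (delta_mx 0 j : 'rV[R]_m) : 'M[R]_(1 + 1, m)) *m B s)
     = Gs s i j.
  by apply: filterS near_g => s [cg _]; rewrite /Gs -gram_pull // mxE.
(* By [lie_curve] the derivative of each entry is a component of [lie X G], which is zero. *)
have dG i j : is_derive (0 : R) (1 : R) (fun s => Gs s i j) 0.
  apply: near_eq_is_derive (GsE i j) _.
  by apply: (is_derive_eq (lie_curve Gt _ cx dX)); exact: XG.
have ddet : is_derive (0 : R) (1 : R) (fun s => \det (Gs s)) 0.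
  apply: (falg_det (P := fun f => is_derive (0 : R) (1 : R) f 0)) => //.
  - exact: derive0_cst.
  - exact: derive0D.
  - exact: derive0M.
have G0 : Gs 0 = gram G c x by rewrite /Gs g0 B0 trmx1 mulmx1 mul1mx.
have d0 : \det (Gs 0) != 0 by rewrite G0 -unitfE -unitmxE; exact: Gu.
have near_u : \forall s \near (0 : R), Gs s \in unitmx.
  apply: filterS (filterI near_g near_B) => s [[cg _] Bs].
  by rewrite /Gs !unitmx_mul unitmx_tr Gu // !unitmxE !unitfE gt_eqF.
have dvs : is_derive (0 : R) (1 : R) vs 0.
  have dc : {for (0 : R), continuous (fun s => \det (Gs s))}.
    by apply: differentiable_continuous; apply/derivable1_diffP; case: ddet.
  have nvs : \forall s \near (0 : R),
      sgn c x * Num.sqrt (Num.sg (\det (Gs 0)) * \det (Gs s)) = vs s.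
    by apply: filterS (near_sg dc d0) => s sE; rewrite /vs normrEsg sE.
  have df := derive0M (derive0_cst (Num.sg (\det (Gs 0)))) ddet.
  have f0 : 0 < Num.sg (\det (Gs 0)) * \det (Gs 0) by rewrite -normrEsg normr_gt0.
  exact: near_eq_is_derive nvs (derive0M (derive0_cst (sgn c x)) (derive0_sqrt f0 df)).
have dxi V : is_derive (0 : R) (1 : R) (fun s => xis s V) (lambda * xis 0 V).
  apply: (is_derive_eq (lie_curve xit V cx dX)).
  by rewrite /xis g0 B0 mulmx1; exact: Xxi.
have DS : is_derive (0 : R) (1 : R) (fun s => star_covector
    ((\det (Gs s))^-1 *: \adj (Gs s)) (vs s) (xis s) W)
    (lambda * star_covector
    ((\det (Gs 0))^-1 *: \adj (Gs 0)) (vs 0) (xis 0) W).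
  apply: (@fmod_star R _ (fun f => is_derive (0 : R) (1 : R) f 0) _ _ _
     (fun f => is_derive (0 : R) (1 : R) f (lambda * f 0))).
  - exact: derive0_cst.
  - exact: derive0D.
  - exact: derive0M.
  - by rewrite mulr0; exact: derive0_cst.
  - exact: derive_eigenD.
  - exact: derive_eigenM.
  - exact: dG.
  - exact: derive0V.
  - exact: dvs.
  - exact: dxi.
(* By naturality, the star of the pulled-back data is the pulled-back star, whose derivative at [0]
   is its Lie derivative by [D1]; the two derivatives are then compared. *)
have near_eq : \forall s \near (0 : R), star_covector
    ((\det (Gs s))^-1 *: \adj (Gs s)) (vs s) (xis s) W =
    hodge G sgn (l := l) xi c (s *: X c x + x) (W *m (1%:M + s *: A)).
  apply: filterS (filterI near_u (filterI near_g near_B)) => s [us [[cg sg] Bs]].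
  rewrite hodgeE //.
  have -> : (\det (Gs s))^-1 *: \adj (Gs s) = invmx (Gs s) by rewrite /invmx us.
  have -> : vs s = vol c (g s) * \det (B s).
    by rewrite /vol -volume_pull sg (gtr0_sg Bs) mulr1.
  apply: star_covector_mul => //.
  - by case: xit => H _ _; exact: H.
  - by rewrite unitmxE unitfE gt_eqF.
  - exact: Gu.
have D2 := near_eq_is_derive near_eq DS.
rewrite -(is_derive_E D1) (is_derive_E D2); congr (_ * _).
by have := nbhs_singleton near_eq; rewrite scale0r add0r scale0r addr0 mulmx1.
Qed.

End Star.
End Hodge.

(** * Principal bundles and Carrollian metrics *)

Section Product.
Variables (R : realType) (m p : nat) (M : manifold R m) (N : manifold R p).

Lemma rsubmx_scalar (x : 'rV[R]_m) (t : R) :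
  rsubmx (row_mx x t%:M : 'rV[R]_(m + 1)) 0 0 = t.
Proof. by rewrite row_mxKr mxE eqxx. Qed.

Lemma open_times_Rx (f : M -> R -> N) (U : set M) c c' : open U ->
  smooth_on_times_Rx f U ->
  open [set w : 'rV[R]_(m + 1) | [/\ (coord c @` (dom c `&` U)) (lsubmx w),
     rsubmx w 0 0 != 0 & dom c' (f (icoord c (lsubmx w)) (rsubmx w 0 0))]].
Proof.
move=> oU [fc _]; rewrite openE => w [lw rw fw].
have lc : {for w, continuous (lsubmx : 'rV[R]_(m + 1) -> 'rV[R]_m)} by exact: continuous_lsubmx.
have rc : {for w, continuous (fun w : 'rV[R]_(m + 1) => rsubmx w 0 0 : R)}.
  apply: differentiable_continuous.
  apply: (differentiable_comp (f := rsubmx) (g := fun u : 'M[R]_(1, 1) => u 0 0)).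
    exact: differentiable_rsubmx.
  exact: differentiable_coord.
have n1 : \forall w' \near w, (coord c @` (dom c `&` U)) (lsubmx w').
  by apply: lc; apply: open_nbhs_nbhs; split => //; exact: open_coord.
have n2 : \forall w' \near w, rsubmx w' 0 0 != 0.
  exact: (cvgr_neq0 _ rc rw).
have [q [cq Uq] qE] := lw.
have ic : {for w, continuous (fun w : 'rV[R]_(m + 1) => icoord c (lsubmx w))}.
  apply: continuous_comp; first exact: lc.
  by rewrite -qE; exact: icoord_cts.
have pc : {for w, continuous
    (fun w : 'rV[R]_(m + 1) => (icoord c (lsubmx w), rsubmx w 0 0))}.
  exact: cvg_pair ic rc.
have ffc : {for w, continuous
    (fun w : 'rV[R]_(m + 1) => f (icoord c (lsubmx w)) (rsubmx w 0 0))}.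
  have fcw : {for (icoord c (lsubmx w), rsubmx w 0 0 : R),
      continuous (fun z : M * R => f z.1 z.2)}.
    by apply: fc => //; rewrite -qE coordK.
  exact: continuous_comp pc fcw.
have n3 : \forall w' \near w, dom c' (f (icoord c (lsubmx w')) (rsubmx w' 0 0)).
  by apply: ffc; apply: open_nbhs_nbhs; split => //; exact: dom_open.
by apply: filterS (filterI n1 (filterI n2 n3)) => w' [h1 [h2 h3]]; split.
Qed.

End Product.

(** * The action in charts and the Euler field *)

Section Flow.
Variables (R : realType) (n : nat) (B : principal_bundle R n).

(** Position and group parameter share one row vector, so that mixed derivatives in the two can be
    exchanged. *)
Definition flow_chart (c c' : chart (total_space B)) (w : 'rV[R]_(n + 1 + 1)) :
    'rV[R]_(n + 1) :=
  coord c' (act (rsubmx w 0 0) (icoord c (lsubmx w))).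

Definition flow_dom (c c' : chart (total_space B)) : set 'rV[R]_(n + 1 + 1) :=
  [set w | [/\ (coord c @` (dom c `&` setT)) (lsubmx w), rsubmx w 0 0 != 0 &
     dom c' (act (rsubmx w 0 0) (icoord c (lsubmx w)))]].

Lemma flow_smooth c c' : smooth_on (flow_chart c c') (flow_dom c c').
Proof. exact: (proj2 (act_smooth B) c c'). Qed.

Lemma flow_dom_open c c' : open (flow_dom c c').
Proof. exact: (open_times_Rx (c := c) (c' := c') openT (act_smooth B)). Qed.

Lemma flow_dom_row (c c' : chart (total_space B)) p a :
  dom c p -> a != 0 -> dom c' (act a p) ->
  flow_dom c c' (row_mx (coord c p) a%:M).
Proof.
by move=> cp a0 cp'; split; rewrite ?rsubmx_scalar ?row_mxKl ?coordK //; exists p.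
Qed.

Lemma flow_chartE (c c' : chart (total_space B)) p a : dom c p ->
  flow_chart c c' (row_mx (coord c p) a%:M) = coord c' (act a p).
Proof. by move=> cp; rewrite /flow_chart rsubmx_scalar row_mxKl coordK. Qed.

Lemma act_continuous (p : total_space B) :
  {for 0, continuous (fun s : R => act (expR s) p)}.
Proof.
have [H _] := act_smooth B.
have pc : {for (0 : R), continuous (fun s : R => (p, expR s))}.
  exact: (cvg_pair (cvg_cst p) (@continuous_expR R 0)).
have ac : {for (p, expR 0), continuous (fun z : total_space B * R => act z.2 z.1)}.
  by apply: H; rewrite // expR0 oner_eq0.
exact: continuous_comp pc ac.
Qed.

Lemma near_act (c : chart (total_space B)) p : dom c p ->
  \forall s \near (0 : R), dom c (act (expR s) p).
Proof.
move=> cp; have H := @act_continuous p.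
have : nbhs (act (expR 0) p) (dom c).
  by rewrite expR0 act1; apply: open_nbhs_nbhs; split => //; exact: dom_open.
exact: H.
Qed.

Lemma differentiable_row_mx (V : normedModType R) k l (f : V -> 'rV[R]_k)
    (g : V -> 'rV[R]_l) x : differentiable f x -> differentiable g x ->
  differentiable (fun y => row_mx (f y) (g y)) x.
Proof.
move=> df dg; apply: differentiable_rV => j.
case: (split_ordP j) => i ->.
  by under eq_fun do rewrite row_mxEl; exact: differentiable_rV_coord.
by under eq_fun do rewrite row_mxEr; exact: differentiable_rV_coord.
Qed.

Lemma derive_row_mx (V : normedModType R) k l (f : V -> 'rV[R]_k)
    (g : V -> 'rV[R]_l) x v : differentiable f x -> differentiable g x ->
  'D_v (fun y => row_mx (f y) (g y)) x = row_mx ('D_v f x) ('D_v g x).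
Proof.
move=> df dg; apply/rowP => j.
have dfg := differentiable_row_mx df dg.
rewrite (derive_coord _ _ (diff_derivable dfg)).
case: (split_ordP j) => i ->.
  rewrite row_mxEl (derive_coord _ _ (diff_derivable df)).
  by under eq_fun do rewrite row_mxEl.
rewrite row_mxEr (derive_coord _ _ (diff_derivable dg)).
by under eq_fun do rewrite row_mxEr.
Qed.

Lemma expR_mx_derive : differentiable (fun s : R => (expR s)%:M : 'rV[R]_1) 0 /\
  'D_1 (fun s : R => (expR s)%:M : 'rV[R]_1) 0 = 1%:M.
Proof.
have dE : is_derive (0 : R) (1 : R) (expR : R -> R) 1.
  by apply: (is_derive_eq (is_derive_expR (0 : R))); rewrite expR0.
have D : differentiable (fun s : R => (expR s)%:M : 'rV[R]_1) 0.
  apply: differentiable_rV => j; rewrite (ord1 j).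
  under eq_fun do rewrite mxE eqxx mulr1n.
  by apply/derivable1_diffP; case: dE.
split => //; apply/rowP => j; rewrite (ord1 j) (derive_coord _ _ (diff_derivable D)).
under eq_fun do rewrite mxE eqxx mulr1n.
by rewrite (is_derive_E dE) mxE eqxx.
Qed.

(** The direction of the group parameter; since [expR] has derivative [1] at [0], it is the initial
    velocity of [s |-> (x, e^s)]. *)
Let dt : 'rV[R]_(n + 1 + 1) := row_mx 0 1%:M.

Lemma exp_curve_derive (x : 'rV[R]_(n + 1)) :
  differentiable (fun s : R => row_mx x (expR s)%:M : 'rV[R]_(n + 1 + 1)) 0 /\
  'D_1 (fun s : R => row_mx x (expR s)%:M : 'rV[R]_(n + 1 + 1)) 0 = dt.
Proof.
have [d1 d2] := expR_mx_derive.
have dx : differentiable (fun=> x : 'rV[R]_(n + 1)) (0 : R) by exact: differentiable_cst.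
split; first exact: differentiable_row_mx.
by rewrite derive_row_mx // d2; congr row_mx; exact: derive_cst.
Qed.

Lemma flow_derive (W : normedModType R) (c c' : chart (total_space B)) (p : total_space B)
    (h : 'rV[R]_(n + 1 + 1) -> W) : dom c p -> dom c' p ->
  smooth_on h (flow_dom c c') ->
  is_derive (0 : R) (1 : R) (fun s : R => h (row_mx (coord c p) (expR s)%:M))
    ('D_dt h (row_mx (coord c p) 1%:M)).
Proof.
move=> cp cp' hs; have [d1 d2] := exp_curve_derive (coord c p).
have g0 : (row_mx (coord c p) (expR 0)%:M : 'rV[R]_(n + 1 + 1)) = row_mx (coord c p) 1%:M.
  by rewrite expR0.
have hd : differentiable h (row_mx (coord c p) (expR 0)%:M).
  rewrite g0; apply: (smooth_on_differentiable hs).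
  by apply: flow_dom_row; rewrite ?oner_eq0 ?act1.
by have := @is_derive_chain R R W _ _ _ 0 1 d1 hd; rewrite d2 g0.
Qed.

(** [euler] is a bare [derive1]; this supplies the differentiability that makes it a genuine
    velocity. *)
Lemma euler_flow (c : chart (total_space B)) p : dom c p ->
  is_derive (0 : R) (1 : R) (fun s : R => coord c (act (expR s) p))
    (euler c (coord c p)).
Proof.
move=> cp; have D := flow_derive cp cp (@flow_smooth c c).
have E : (fun s : R => flow_chart c c (row_mx (coord c p) (expR s)%:M)) =
    fun s => coord c (act (expR s) p) by apply/funext => s; rewrite flow_chartE.
rewrite E in D.
have X0 : euler c (coord c p) = 'D_1 (fun s : R => coord c (act (expR s) p)) 0.
  by rewrite /euler (coordK cp) derive1E.
rewrite X0 (is_derive_E D); exact: D.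
Qed.

Lemma eulerE (c : chart (total_space B)) p : dom c p ->
  euler c (coord c p) = 'D_dt (flow_chart c c) (row_mx (coord c p) 1%:M).
Proof.
move=> cp; have D := flow_derive cp cp (@flow_smooth c c).
have E : (fun s : R => flow_chart c c (row_mx (coord c p) (expR s)%:M)) =
    fun s => coord c (act (expR s) p) by apply/funext => s; rewrite flow_chartE.
rewrite E in D; exact: etrans (esym (is_derive_E (euler_flow cp))) (is_derive_E D).
Qed.

(** By [eulerE] the field is a partial derivative of the action restricted to the slice where the
    parameter is [1], and this slice is an affine embedding. *)
Lemma euler_smooth (c : chart (total_space B)) : smooth_on (@euler R n B c) (cod c).
Proof.
pose h (x : 'rV[R]_(n + 1)) : 'rV[R]_(n + 1 + 1) := row_mx x 1%:M.
have hd x : differentiable h x.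
  apply: differentiable_row_mx; first exact: ex_diff.
  exact: differentiable_cst.
have hL (s : R) (v x : 'rV[R]_(n + 1)) :
    h (s *: v + x) = s *: (row_mx v 0 : 'rV[R]_(n + 1 + 1)) + h x.
  by rewrite /h scale_row_mx add_row_mx scaler0 add0r.
have Fs := smooth_on_affine hL hd (smooth_on_derive dt (@flow_smooth c c)).
have oc := @cod_open R (n + 1) (total_space B) c.
move=> r; apply: (Ck_on_ext (f := fun x => 'D_dt (flow_chart c c) (h x))) => //.
  by move=> _ [p cp <-]; rewrite eulerE.
apply: Ck_on_subset (Fs r) => _ [p cp <-] /=.
by apply: flow_dom_row; rewrite ?oner_eq0 ?act1.
Qed.

Lemma is_vfield_euler : is_vfield (@euler R n B).
Proof.
split; first exact: euler_smooth.
move=> c c' p cp cp'.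
have D := euler_flow cp; have D' := euler_flow cp'.
have dphi : differentiable (fun s : R => coord c (act (expR s) p)) (0 : R).
  by apply/derivable1_diffP; case: D.
have p0 : coord c (act (expR 0) p) = coord c p by rewrite expR0 act1.
have dtau := transition_differentiable cp cp'.
have dtau0 : differentiable (local_map idfun c c') (coord c (act (expR 0) p)) by rewrite p0.
have D2 := @is_derive_chain R R _ _ _ _ 0 1 dphi dtau0.
have E : \forall s \near (0 : R), local_map idfun c c' (coord c (act (expR s) p)) =
    coord c' (act (expR s) p).
  by apply: filterS (near_act cp) => s cs; rewrite local_mapE.
have D3 := near_eq_is_derive E D2.
apply: etrans (esym (is_derive_E D')) (etrans (is_derive_E D3) _).
by rewrite (is_derive_E D) p0; exact: deriveEjacobian.
Qed.

End Flow.

(** * Invertibility from a one-dimensional kernel *)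

Section LinearAlgebra.
Variable F : fieldType.

Lemma left_kernel_line (n p : nat) (A : 'M[F]_(n + 1, p)) (x v : 'rV[F]_(n + 1)) :
  \rank A = n -> x != 0 -> x *m A = 0 -> v *m A = 0 -> exists a, v = a *: x.
Proof.
move=> rA x0 xA vA.
have xK : (x <= kermx A)%MS by apply/sub_kermxP.
have vK : (v <= kermx A)%MS by apply/sub_kermxP.
have rK : \rank (kermx A) = 1%N by rewrite mxrank_ker rA addKn.
have : (kermx A <= x)%MS.
  by rewrite -(mxrank_leqif_sup xK).2 rK rank_rV x0.
by move=> Kx; apply/sub_rVP; exact: submx_trans vK Kx.
Qed.

Lemma unitmx_inj (n : nat) (A : 'M[F]_n) :
  (forall v : 'rV_n, v *m A = 0 -> v = 0) -> A \in unitmx.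
Proof.
move=> H; rewrite -row_free_unit -kermx_eq0; apply/rowV0P => v /sub_kermxP.
exact: H.
Qed.

Lemma row_mx_unit (n : nat) (A : 'M[F]_(n + 1, n)) (t : 'cV[F]_(n + 1))
    (x : 'rV[F]_(n + 1)) : \rank A = n -> x *m A = 0 -> x *m t = 1%:M ->
  row_mx A t \in unitmx.
Proof.
move=> rA xA xt; apply: unitmx_inj => v.
move=> v0; have : row_mx (v *m A) (v *m t) = row_mx 0 0.
  by rewrite -mul_mx_row v0 row_mx0.
move=> /eq_row_mx[vA vt].
have x0 : x != 0.
  by apply/eqP => x0; move: xt; rewrite x0 mul0mx => /matrixP/(_ 0 0)/eqP;
    rewrite !mxE eqxx eq_sym oner_eq0.
have [a vE] := left_kernel_line rA x0 xA vA.
move: vt; rewrite vE -scalemxAl xt => /matrixP/(_ 0 0).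
by rewrite !mxE eqxx mulr1 => ->; rewrite scale0r.
Qed.

(** If [v] is in the kernel then [v A = (v t) t^T]. Pairing with [x], which [A] kills on both sides
    by symmetry, gives [v t = 0]; so [v A = 0], [v] is a multiple of [x], and [x t = 1] makes it
    zero. *)
Lemma rank_one_update_unit (n : nat) (A : 'M[F]_(n + 1)) (t : 'cV[F]_(n + 1))
    (x : 'rV[F]_(n + 1)) : \rank A = n -> A^T = A -> x *m A = 0 ->
  x *m t = 1%:M -> A - t *m t^T \in unitmx.
Proof.
move=> rA As xA xt; apply: unitmx_inj => v.
rewrite mulmxBr mulmxA => /eqP; rewrite subr_eq0 => /eqP vE.
have x0 : x != 0.
  by apply/eqP => x0; move: xt; rewrite x0 mul0mx => /matrixP/(_ 0 0)/eqP;
    rewrite !mxE eqxx eq_sym oner_eq0.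
have Ax : A *m x^T = 0 by rewrite -As -trmx_mul xA trmx0.
have tx : t^T *m x^T = 1%:M by rewrite -trmx_mul xt trmx1.
have vt : v *m t = 0.
  by have := congr1 (mulmx^~ x^T) vE; rewrite -!mulmxA Ax tx mulmx0 mulmx1 => <-.
have vA : v *m A = 0 by rewrite vE vt mul0mx.
have [a aE] := left_kernel_line rA x0 xA vA.
move: vt; rewrite aE -scalemxAl xt => /matrixP/(_ 0 0).
by rewrite !mxE eqxx mulr1 => ->; rewrite scale0r.
Qed.

End LinearAlgebra.

(** * Vertical directions, the connection form and the Lorentzian metric *)

Section Bundle.
Variables (R : realType) (n : nat) (B : principal_bundle R n).

Lemma proj_act (p : total_space B) a : a != 0 -> proj (act a p) = proj p.
Proof.
move=> a0; have [U [phi [tau [oU Uy [h1 h2 h3 _ _]]]]] := locally_trivial (proj p).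
have [t0 pE] := h2 _ Uy.
rewrite -[in LHS]pE h3 //.
by have [] := h1 (proj p) (a * tau p) Uy (mulf_neq0 a0 t0).
Qed.

Lemma proj_differentiable (c : chart (total_space B)) (b : chart (base B)) p :
  dom c p -> dom b (proj p) -> differentiable (local_map (@proj R n B) c b) (coord c p).
Proof.
move=> cp bp; have [_ H] := proj_smooth B.
by apply: (smooth_on_differentiable (H c b)); exists p.
Qed.

(** The projection is constant along orbits, and the Euler field is the velocity of an orbit. *)
Lemma euler_vertical (c : chart (total_space B)) (b : chart (base B)) p :
  dom c p -> dom b (proj p) ->
  euler c (coord c p) *m 'J (local_map (@proj R n B) c b) (coord c p) = 0.
Proof.
move=> cp bp; have D := euler_flow cp.
have dphi : differentiable (fun s : R => coord c (act (expR s) p)) (0 : R).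
  by apply/derivable1_diffP; case: D.
have p0 : coord c (act (expR 0) p) = coord c p by rewrite expR0 act1.
have dp := proj_differentiable cp bp.
have dp0 : differentiable (local_map (@proj R n B) c b) (coord c (act (expR 0) p)).
  by rewrite p0.
have D2 := @is_derive_chain R R _ _ _ _ 0 1 dphi dp0.
have E : \forall s \near (0 : R),
    local_map (@proj R n B) c b (coord c (act (expR s) p)) = cst (coord b (proj p)) s.
  apply: filterS (near_act cp) => s cs.
  by rewrite /local_map coordK // proj_act // gt_eqF // expR_gt0.
have D3 := near_eq_is_derive E D2.
apply: etrans (esym (deriveEjacobian _ dp)) _.
have := is_derive_E D3; rewrite (is_derive_E D) p0 => <-.
exact: derive_cst.
Qed.

(** A local section through [p] is inverted by the projection, so its Jacobian times [A] is the
    identity of size [n]. *)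
Lemma proj_jacobian_rank (c : chart (total_space B)) (b : chart (base B)) p :
  dom c p -> dom b (proj p) ->
  \rank ('J (local_map (@proj R n B) c b) (coord c p)) = n.
Proof.
move=> cp bp; set A := 'J _ _.
have [U [phi [tau [oU Uy [h1 h2 h3 h4 h5]]]]] := locally_trivial (proj p).
have [t0 pE] := h2 _ Uy.
set y := proj p in bp Uy pE *; set t := tau p in t0 pE *.
pose S := [set w : 'rV[R]_(n + 1) | [/\ (coord b @` (dom b `&` U)) (lsubmx w),
  rsubmx w 0 0 != 0 & dom c (phi (icoord b (lsubmx w)) (rsubmx w 0 0))]].
pose H (w : 'rV[R]_(n + 1)) := coord c (phi (icoord b (lsubmx w)) (rsubmx w 0 0)).
have Hs : smooth_on H S by exact: (proj2 h4 b c).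
have oS : open S by exact: open_times_Rx.
pose z0 := coord b y.
(* The section keeps the fibre coordinate frozen at the value [t] it has at [p]. *)
pose i (z : 'rV[R]_n) : 'rV[R]_(n + 1) := row_mx z t%:M.
have Hi z : H (i z) = coord c (phi (icoord b z) t).
  by rewrite /H /i rsubmx_scalar row_mxKl.
have Si : S (i z0).
  by split; rewrite ?rsubmx_scalar ?row_mxKl /z0 ?coordK ?pE //; exists y.
have di z : differentiable i z.
  apply: differentiable_row_mx; first exact: ex_diff.
  exact: differentiable_cst.
have dH : differentiable H (i z0) by exact: smooth_on_differentiable Hs Si.
have ds : differentiable (H \o i) z0 by exact: differentiable_comp.
have s0 : (H \o i) z0 = coord c p by rewrite /= Hi /z0 coordK // pE.
have dp : differentiable (local_map (@proj R n B) c b) ((H \o i) z0).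
  by rewrite s0; exact: proj_differentiable.
have E : \forall z \near z0, (local_map (@proj R n B) c b \o (H \o i)) z = idfun z.
  have nS : \forall z \near z0, S (i z).
    have ic : {for z0, continuous i} by exact: differentiable_continuous.
    by apply: ic; apply: open_nbhs_nbhs.
  apply: filterS nS => z [[q [bq Uq] qE] _].
  rewrite /= Hi /i rsubmx_scalar row_mxKl => hc.
  move: qE hc; rewrite row_mxKl => <-; rewrite coordK // => hc.
  by rewrite /local_map coordK //; have [-> _] := h1 q t Uq t0.
have J1 : 'J (H \o i) z0 *m A = 1%:M.
  rewrite -(jacobian_id z0) -(near_eq_jacobian E); last exact: differentiable_comp.
  by rewrite (jacobian_comp ds dp) s0.
apply/eqP; rewrite eqn_leq rank_leq_col /=.
by rewrite -{1}(mxrank1 R n) -J1 mxrankM_maxr.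
Qed.

Section Connection.
Variables (theta : tfield (total_space B) 1).
Hypothesis htheta : is_connection_form theta.

Let th : is_form theta. Proof. by case: htheta. Qed.

Definition theta_col (c : chart (total_space B)) (x : 'rV[R]_(n + 1)) : 'cV[R]_(n + 1) :=
  \col_(i < n + 1) theta c x (delta_mx 0 i).

Lemma theta_colE c x (v : 'rV[R]_(n + 1)) : cod c x -> v *m theta_col c x = (theta c x v)%:M.
Proof.
move=> cx; apply/matrixP => i j; rewrite (ord1 i) (ord1 j) !mxE eqxx mulr1n.
have tl := form_multilinear th cx.
rewrite -[in RHS](set_row1 ord0 v v) [X in set_row _ X _]row_sum_delta multilinear_sum //.
by apply: eq_bigr => a _; rewrite multilinearZ // set_row1 mxE.
Qed.

Lemma euler_theta c x : cod c x -> euler c x *m theta_col c x = 1%:M.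
Proof. by move=> cx; rewrite theta_colE //; case: htheta => _ _ ->. Qed.

(** Invariance says that [theta], evaluated at [g s] on the push-forward [N s] of [v], is constant
    in [s]. Its derivative at [0], computed by [is_derive_tensor], is the Lie derivative once [N] is
    known to have velocity ['D_v] of the Euler field. *)
Lemma lie_euler_theta : tfield_eq (lie (@euler R n B) theta) (fun c x V => 0).
Proof.
move=> c _ [p cp <-] v; set x := coord c p.
have cx : cod c x by exact: cod_coord.
have dX : differentiable (@euler R n B c) x.
  exact: smooth_on_differentiable (@euler_smooth R n B c) cx.
rewrite /lie big_ord1 set_row1 row_id.
pose F := flow_chart (B := B) c c.
pose g (s : R) := coord c (act (expR s) p).
pose e (v : 'rV[R]_(n + 1)) : 'rV[R]_(n + 1 + 1) := row_mx v 0.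
pose dt : 'rV[R]_(n + 1 + 1) := row_mx 0 1%:M.
(* The push-forward of [v] under [act (expR s)], written as a partial derivative of the joint map so
   that it is differentiable in [s]. *)
pose N (s : R) : 'rV[R]_(n + 1) := 'D_(e v) F (row_mx x (expR s)%:M).
have Fs := @flow_smooth R n B c c.
have oF := @flow_dom_open R n B c c.
have D1 := euler_flow cp; rewrite -/x in D1.
have dg : differentiable g 0 by apply/derivable1_diffP; case: D1.
have g0 : g 0 = x by rewrite /g expR0 act1.
have D2 : is_derive (0 : R) (1 : R) N ('D_v (@euler R n B c) x).
  have D := flow_derive cp cp (smooth_on_derive (e v) Fs).
  have S1 : flow_dom (B := B) c c (row_mx x 1%:M).
    by apply: flow_dom_row; rewrite ?oner_eq0 ?act1.
  apply: (is_derive_eq D).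
  (* Exchanging the derivatives in position and parameter turns the velocity of the push-forward
     into the derivative of the Euler field along [v]. *)
  apply: etrans (smooth_derive_sym_rV (e v) dt oF Fs S1) _.
  pose K (w : 'rV[R]_(n + 1 + 1)) := 'D_dt F w.
  pose h (y : 'rV[R]_(n + 1)) : 'rV[R]_(n + 1 + 1) := row_mx y 1%:M.
  have did : differentiable (fun y : 'rV[R]_(n + 1) => y) x by exact: ex_diff.
  have d1 : differentiable (fun _ : 'rV[R]_(n + 1) => 1%:M : 'rV[R]_1) x.
    exact: differentiable_cst.
  have dh : differentiable h x by exact: differentiable_row_mx.
  have hv : 'D_v h x = e v.
    have h1 : 'D_v (fun y : 'rV[R]_(n + 1) => y) x = v := derive_id x v.
    have h2 : 'D_v (fun _ : 'rV[R]_(n + 1) => 1%:M : 'rV[R]_1) x = 0 := derive_cst _ x v.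
    by rewrite (derive_row_mx v did d1) h1 h2.
  have dK : differentiable K (h x).
    exact: (smooth_on_differentiable (smooth_on_derive dt Fs) S1).
  have DK := is_derive_chain v dh dK; rewrite hv in DK.
  have E : \forall y \near x, K (h y) = euler c y.
    apply: filterS (near_cod cx) => _ [q cq <-]; exact: esym (eulerE cq).
  exact: esym (is_derive_E (near_eq_is_derive E DK)).
have NE (s : R) : dom c (act (expR s) p) ->
    N s = v *m 'J (local_map (@act R n B (expR s)) c c) x.
  move=> cs.
  have Ss : flow_dom (B := B) c c (row_mx x (expR s)%:M).
    by apply: flow_dom_row; rewrite // gt_eqF // expR_gt0.
  have lE : local_map (@act R n B (expR s)) c c = fun y => F (row_mx y (expR s)%:M).
    by apply/funext => y; rewrite /F /flow_chart rsubmx_scalar row_mxKl.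
  have did : differentiable (fun y : 'rV[R]_(n + 1) => y) x by exact: ex_diff.
  have d1 : differentiable (fun _ : 'rV[R]_(n + 1) => (expR s)%:M : 'rV[R]_1) x.
    exact: differentiable_cst.
  have dh := differentiable_row_mx did d1.
  have dF : differentiable F (row_mx x (expR s)%:M).
    exact: smooth_on_differentiable Fs Ss.
  have hv : 'D_v (fun y : 'rV[R]_(n + 1) => row_mx y (expR s)%:M : 'rV[R]_(n + 1 + 1)) x = e v.
    have h1 : 'D_v (fun y : 'rV[R]_(n + 1) => y) x = v := derive_id x v.
    have h2 : 'D_v (fun _ : 'rV[R]_(n + 1) => (expR s)%:M : 'rV[R]_1) x = 0 := derive_cst _ x v.
    by rewrite (derive_row_mx v did d1) h1 h2.
  have DF := is_derive_chain v dh dF; rewrite hv in DF.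
  rewrite lE; apply: etrans (esym (is_derive_E DF)) _.
  exact: deriveEjacobian (differentiable_comp dh dF).
have N0 : N 0 = v.
  have c1 : dom c (act (expR 0) p) by rewrite expR0 act1.
  have E : \forall y \near x, idfun y = local_map (@act R n B 1) c c y.
    apply: filterS (near_cod cx) => _ [q cq <-].
    by rewrite /local_map coordK // act1.
  have did : differentiable (idfun : 'rV[R]_(n + 1) -> 'rV[R]_(n + 1)) x by exact: ex_diff.
  have J1 := etrans (esym (near_eq_jacobian E did)) (jacobian_id x).
  by rewrite (NE 0 c1) expR0 J1 mulmx1.
have tinv : \forall s \near (0 : R), cst (theta c x v) s = theta c (g s) (N s).
  apply: filterS (near_act cp) => s cs; rewrite NE //; apply/esym.
  by case: htheta => _ H _; apply: H => //; rewrite gt_eqF // expR_gt0.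
have dN : differentiable N 0 by apply/derivable1_diffP; case: D2.
have T1 : \forall z \near g 0, multilinear (theta c z).
  by rewrite g0; exact: near_form_multilinear.
have T2 A : differentiable (fun z => theta c z A) (g 0).
  by rewrite g0; exact: form_differentiable.
have D3 := is_derive_tensor dg T1 T2 (fun i j => @is_derive_coord R R _ N 0 1 i j dN).
rewrite big_ord1 set_row1 row_id (is_derive_E D1) (is_derive_E D2) g0 N0 in D3.
apply: etrans (esym (is_derive_E D3)) _.
apply: etrans (esym (near_eq_derive (1 : R) tinv)) _; exact: derive_cst.
Qed.

Lemma theta_linear c x a (u v : 'rV[R]_(n + 1)) : cod c x ->
  theta c x (a *: u + v) = a * theta c x u + theta c x v.
Proof.
move=> cx; have := form_multilinear th cx ord0 a u v 0.
by rewrite !set_row1.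
Qed.

Lemma theta_transition c c' p v : dom c p -> dom c' p ->
  theta c (coord c p) v = theta c' (coord c' p) (v *m 'J (local_map idfun c c') (coord c p)).
Proof. by move=> cp cp'; case: th => -[_ _ H] _; exact: H. Qed.

Section Lorentz.
Variable g : tfield (total_space B) 2.
Hypothesis gt : is_tensor g.

Lemma is_tensor_lorentz : is_tensor (lorentz_metric g theta).
Proof.
have [gl gs gtr] := gt; split.
- move=> c x cx i a u v V; rewrite /lorentz_metric (gl c x cx) !row_set_row.
  by case: i => -[|[|//]] hi /=; rewrite theta_linear //; ring.
- move=> c V r; have oc := @cod_open R (n + 1) (total_space B) c.
  apply: Ck_onD => //; first exact: gs.
  by apply: Ck_onN => //; apply: Ck_onM => //; exact: (form_smooth th).
- move=> c c' p cp cp' V; rewrite /lorentz_metric (gtr c c' p cp cp') !row_mul.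
  by rewrite -!theta_transition.
Qed.

Lemma lorentz_sum c x (u : 'I_2 -> 'rV[R]_(n + 1)) V :
  \sum_(i < 2) lorentz_metric g theta c x (set_row i (u i) V) =
  \sum_(i < 2) g c x (set_row i (u i) V) -
  (theta c x (u 0) * theta c x (row 1 V) + theta c x (row 0 V) * theta c x (u 1)).
Proof.
have E : lift ord0 ord0 = 1 :> 'I_2 by exact/val_inj.
rewrite !big_ord_recl !big_ord0 /lorentz_metric !row_set_row !E /=; ring.
Qed.

Lemma lie_lorentz : tfield_eq (lie (@euler R n B) g) (fun c x V => 0) ->
  tfield_eq (lie (@euler R n B) (lorentz_metric g theta)) (fun c x V => 0).
Proof.
move=> Xg c x cx V.
have Xt w : 'D_(euler c x) (fun y => theta c y w) x =
    - theta c x ('D_w (@euler R n B c) x).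
  have := lie_euler_theta cx (w : 'M[R]_(1, n + 1)).
  rewrite /lie big_ord1 set_row1 row_id => /eqP; rewrite addr_eq0 => /eqP.
  exact.
have Dg : is_derive x (euler c x) (fun y => g c y V) ('D_(euler c x) (fun y => g c y V) x).
  by apply: derivableP; apply: diff_derivable; exact: (tensor_differentiable gt).
have Dt w := is_derive_eq (form_is_derive th w (euler c x) cx) (Xt w).
have D := is_derive_addf Dg (is_deriveN (is_derive_mulf (Dt (row 0 V)) (Dt (row 1 V)))).
have S := lorentz_sum c x (fun i => 'D_(row i V) (@euler R n B c) x) V.
(* [d + s] is the Lie derivative of [g]. The rates [- a] and [- b] of the two factors [theta] cancel
   against the terms from their moving arguments. *)
have alg (d s a b t0 t1 : R) : d + s = 0 ->
    d + - (- a * t1 + t0 * - b) + (s - (a * t1 + t0 * b)) = 0.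
  by move=> <-; ring.
rewrite /lie S; apply: etrans (congr1 (fun z => z + _) (is_derive_E D)) _.
exact: alg (Xg c x cx V).
Qed.

End Lorentz.
End Connection.
End Bundle.

Lemma row0_col_mx (R : Type) (n : nat) (u v : 'rV[R]_n) :
  row (0 : 'I_2) (col_mx u v : 'M[R]_(1 + 1, n)) = u.
Proof.
have E : (0 : 'I_2) = lshift 1 (0 : 'I_1) by exact/val_inj.
by apply/rowP => b; rewrite mxE E; exact: col_mxEu.
Qed.

Lemma row1_col_mx (R : Type) (n : nat) (u v : 'rV[R]_n) :
  row (1 : 'I_2) (col_mx u v : 'M[R]_(1 + 1, n)) = v.
Proof.
have E : (1 : 'I_2) = rshift 1 (0 : 'I_1) by exact/val_inj.
by apply/rowP => b; rewrite mxE E; exact: col_mxEd.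
Qed.

Section Carroll.
Variables (R : realType) (n : nat) (B : principal_bundle R n).
Variable theta : tfield (total_space B) 1.
Hypothesis htheta : is_connection_form theta.

Let th : is_form theta. Proof. by case: htheta. Qed.

Section Metric.
Variable g : tfield (total_space B) 2.
Hypothesis hg : is_carrollian g.

(** The kernel condition speaks of global smooth fields only; it applies because the Euler field is
    one and is vertical everywhere. *)
Lemma carrollian_euler c x (v : 'rV[R]_(n + 1)) : cod c x ->
  g c x (col_mx (euler c x) v) = 0.
Proof.
case: hg => _ _ H _ _ cx; case: (H _ (is_vfield_euler B)) => _ K.
apply: K => // c' _ [p cp <-] b; rewrite coordK // => bp.
exact: euler_vertical.
Qed.

Lemma gram_lorentz c x : cod c x ->
  gram (lorentz_metric g theta) c x =
  gram g c x - theta_col theta c x *m (theta_col theta c x)^T.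
Proof.
move=> cx; apply/matrixP => i j; rewrite !mxE big_ord1 !mxE /lorentz_metric.
by rewrite row0_col_mx row1_col_mx.
Qed.

Lemma gram_lorentz_unit c x : cod c x -> gram (lorentz_metric g theta) c x \in unitmx.
Proof.
move=> cx; rewrite gram_lorentz //.
have [gt gsym _ _ grk] := hg; have [gl _ _] := gt.
apply: (rank_one_update_unit (x := euler c x)).
- exact: grk.
- by apply/matrixP => i j; rewrite !mxE gsym.
- apply/rowP => j; rewrite !mxE.
  have := multilinear2_expand (euler c x) (delta_mx 0 j : 'rV[R]_(n + 1)) (gl c x cx).
  rewrite carrollian_euler // => E; rewrite [RHS]E; apply: eq_bigr => a _.
  rewrite (bigD1 j) //= big1 ?addr0 => [|b bj].
    by rewrite !mxE !eqxx mulr1.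
  by rewrite !mxE (negPf bj) andbF mulr0.
- exact: euler_theta.
Qed.

End Metric.

(** * The orientation sign of the total space *)

Section Sign.
Variable o : chart (base B) -> base B -> R.
Hypothesis ho : is_orientation o.

Definition frame_mx (c : chart (total_space B)) (b : chart (base B))
    (x : 'rV[R]_(n + 1)) : 'M[R]_(n + 1) :=
  row_mx ('J (local_map (@proj R n B) c b) x) (theta_col theta c x).

Lemma frame_mx_unit c b p : dom c p -> dom b (proj p) ->
  frame_mx c b (coord c p) \in unitmx.
Proof.
move=> cp bp; apply: (row_mx_unit (x := euler c (coord c p))).
- exact: proj_jacobian_rank.
- exact: euler_vertical.
- by apply: euler_theta => //; exact: cod_coord.
Qed.

(** [chart_at] may jump from point to point, so it is traded for an arbitrary base chart. The change
    multiplies the orientation and the determinant by the same sign, whose square is [1]. *)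
Lemma total_signE c b p : dom c p -> dom b (proj p) ->
  total_sign o theta c (coord c p) =
  o b (proj p) * Num.sg (\det (frame_mx c b (coord c p))).
Proof.
move=> cp bp.
set b0 := chart_at (proj p); have b0p : dom b0 (proj p) by exact: dom_chart_at.
have -> : total_sign o theta c (coord c p) =
    o b0 (proj p) * Num.sg (\det (frame_mx c b0 (coord c p))).
  by rewrite /total_sign (coordK cp).
case: ho => _ _ otr; rewrite (otr b b0 _ bp b0p).
set K := 'J _ _.
have dp := proj_differentiable cp bp; have dp0 := proj_differentiable cp b0p.
have pE : local_map (@proj R n B) c b (coord c p) = coord b (proj p).
  by rewrite /local_map coordK.
have dt : differentiable (local_map idfun b b0) (local_map (@proj R n B) c b (coord c p)).
  by rewrite pE; exact: transition_differentiable.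
have E : \forall y \near coord c p,
    (local_map idfun b b0 \o local_map (@proj R n B) c b) y = local_map (@proj R n B) c b0 y.
  have : nbhs p (@proj R n B @^-1` dom b).
    by apply: (proj1 (proj_smooth B)); apply: open_nbhs_nbhs; split => //; exact: dom_open.
  move=> /(near_coord cp); apply: filterS => _ [q [cq bq <-]].
  by rewrite /local_map /= !coordK.
have JE : 'J (local_map (@proj R n B) c b0) (coord c p) =
    'J (local_map (@proj R n B) c b) (coord c p) *m K.
  rewrite -(near_eq_jacobian E); last exact: differentiable_comp.
  by rewrite (jacobian_comp dp dt) pE.
have FE : frame_mx c b0 (coord c p) = frame_mx c b (coord c p) *m block_mx K 0 0 1%:M.
  by rewrite /frame_mx JE mul_row_block !mulmx0 mulmx1 addr0 add0r.
rewrite FE det_mulmx det_ublock det1 mulr1 sgrM.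
have K0 : \det K != 0.
  by rewrite -unitfE -unitmxE; exact: transition_jacobian_unit.
have K2 : Num.sg (\det K) * Num.sg (\det K) = 1 by rewrite -expr2 sqr_sg K0.
move: (Num.sg (\det K)) (o b (proj p)) (Num.sg _) K2 => s q f s2.
by rewrite -[RHS]mul1r -s2; ring.
Qed.

(** With one base chart [b] kept for all nearby points, the sign is that of a continuous determinant
    which is nonzero at the point. *)
Lemma total_sign_near c x : cod c x ->
  \forall y \near x, total_sign o theta c y = total_sign o theta c x.
Proof.
move=> [p cp <-]; pose b := chart_at (proj p).
have bp : dom b (proj p) by exact: dom_chart_at.
have n1 : nbhs p [set q | dom b (proj q) /\ o b (proj q) = o b (proj p)].
  case: ho => _ onear _.
  have pc : {for p, continuous (@proj R n B)} by exact: (proj1 (proj_smooth B)).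
  apply: (pc [set y | dom b y /\ o b y = o b (proj p)]).
  apply: filterI; last exact: onear.
  by apply: open_nbhs_nbhs; split => //; exact: dom_open.
pose O := coord c @` (dom c `&` @proj R n B @^-1` dom b).
have oO : open O.
  apply: open_coord; apply: open_comp; last exact: dom_open.
  by move=> q _; exact: (proj1 (proj_smooth B)).
have Op : O (coord c p) by exists p.
have ps : smooth_on (local_map (@proj R n B) c b) O by exact: (proj2 (proj_smooth B) c b).
have Js i j : smooth_on (fun y => 'J (local_map (@proj R n B) c b) y i j) O.
  have := smooth_on_coord j oO (smooth_on_derive (delta_mx 0 i) ps).
  move=> H r; apply: Ck_on_ext oO _ (H r) => y Oy.
  rewrite (deriveEjacobian _ (smooth_on_differentiable ps Oy)) -rowE; exact: mxE.
have ds : Ck_on 0 (fun y => \det (frame_mx c b y)) O.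
  apply: (falg_det (P := fun f => Ck_on 0 f O)).
  - by move=> a; exact: Ck_on_cst.
  - by move=> f1 f2; exact: Ck_onD.
  - by move=> f1 f2; exact: Ck_onM.
  - move=> i j; rewrite /frame_mx; case: (split_ordP j) => k ->.
      under eq_fun do rewrite row_mxEl.
      exact: (Js i k 0%N).
    under eq_fun do rewrite row_mxEr mxE.
    apply: Ck_on_subset (form_smooth th c _ 0%N).
    by move=> _ [q [cq _] <-]; exact: cod_coord.
have dc : {for coord c p, continuous (fun y => \det (frame_mx c b y))} by exact: ds.
have d0 : \det (frame_mx c b (coord c p)) != 0.
  by rewrite -unitfE -unitmxE; exact: frame_mx_unit.
apply: filterS (filterI (near_coord cp n1) (near_sg dc d0)).
move=> _ [[q [cq [bq oq] <-]] sq].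
by rewrite (total_signE cq bq) (total_signE cp bp) oq sq.
Qed.

(** With the same base chart on both sides, the two frame matrices differ by left multiplication by
    the transition Jacobian. *)
Lemma total_sign_transition c c' p : dom c p -> dom c' p ->
  total_sign o theta c (coord c p) = total_sign o theta c' (coord c' p) *
    Num.sg (\det ('J (local_map idfun c c') (coord c p))).
Proof.
move=> cp cp'; pose b := chart_at (proj p).
have bp : dom b (proj p) by exact: dom_chart_at.
rewrite (total_signE cp bp) (total_signE cp' bp) -mulrA -sgrM [\det _ * _]mulrC -det_mulmx.
congr (_ * Num.sg _); congr determinant.
set J := 'J _ _.
have tE : local_map idfun c c' (coord c p) = coord c' p.
  by rewrite /local_map coordK.
have dt := transition_differentiable cp cp'.
have dp : differentiable (local_map (@proj R n B) c' b) (local_map idfun c c' (coord c p)).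
  by rewrite tE; exact: proj_differentiable.
have E : \forall y \near coord c p,
    (local_map (@proj R n B) c' b \o local_map idfun c c') y = local_map (@proj R n B) c b y.
  have : nbhs p (dom c') by apply: open_nbhs_nbhs; split => //; exact: dom_open.
  move=> /(near_coord cp); apply: filterS => _ [q [cq cq' <-]].
  by rewrite /local_map /= !coordK.
rewrite /frame_mx mul_mx_row; congr row_mx.
  rewrite -(near_eq_jacobian E); last exact: differentiable_comp.
  by rewrite (jacobian_comp dt dp) tE.
apply/matrixP => i j; rewrite mxE (theta_transition htheta _ cp cp').
have cx' : cod c' (coord c' p) by exact: cod_coord.
have := theta_colE htheta (row i J) cx'; rewrite -row_mul => /matrixP/(_ 0 j).
by rewrite mxE (ord1 j) => ->; rewrite mxE eqxx mulr1n rowE.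
Qed.

End Sign.
End Carroll.

(** * Homogeneous forms *)

Section HomogeneousForms.
Variables (R : realType) (m : nat) (M : manifold R m) (X : vfield M) (lambda : R).
Hypothesis Xs : forall c, smooth_on (X c) (cod c).

(** The two properties travel together: differentiating the weight identity, and pulling back the
    star, both need the field to be a smooth form. *)
Definition homogeneous_form k (w : tfield M k) := is_form w /\ homogeneous X lambda w.

Lemma homogeneous_formD k (v w : tfield M k) :
  homogeneous_form v -> homogeneous_form w ->
  homogeneous_form (fun c x V => v c x V + w c x V).
Proof.
move=> [vf vh] [wf wh]; split; last first.
  move=> c x cx V.
  have D := is_derive_addf (form_is_derive vf V (X c x) cx) (form_is_derive wf V (X c x) cx).
  have := congr2 +%R (vh c x cx V) (wh c x cx V); rewrite -mulrDr => <-.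
  rewrite /lie big_split; apply: etrans (congr1 (fun z => z + _) (is_derive_E D)) _.
  exact: addrACA.
split; last by move=> c x cx V i j ij rij; rewrite (form_alternating vf cx ij rij)
  (form_alternating wf cx ij rij) addr0.
have [vl vs vt] := proj1 vf; have [wl ws wt] := proj1 wf; split.
- by move=> c x cx i a u u' V; rewrite (vl c x cx) (wl c x cx) mulrDr addrACA.
- by move=> c V r; apply: Ck_onD; [exact: cod_open|exact: vs|exact: ws].
- by move=> c c' p cp cp' V; rewrite (vt c c' p cp cp') (wt c c' p cp cp').
Qed.

Lemma homogeneous_formZ k a (w : tfield M k) : homogeneous_form w ->
  homogeneous_form (fun c x V => a * w c x V).
Proof.
move=> [wf wh]; split; last first.
  move=> c x cx V.
  have D := is_derive_mulf (is_derive_cst (a : R) x (X c x)) (form_is_derive wf V (X c x) cx).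
  rewrite mulrCA -(wh c x cx V) /lie -mulr_sumr.
  apply: etrans (congr1 (fun z => z + _) (is_derive_E D)) _.
  by rewrite mul0r add0r mulrDr.
split; last by move=> c x cx V i j ij rij; rewrite (form_alternating wf cx ij rij) mulr0.
have [wl ws wt] := proj1 wf; split.
- by move=> c x cx i b u u' V; rewrite (wl c x cx) mulrDr mulrCA.
- move=> c V r; apply: Ck_onM; [exact: cod_open|exact: Ck_on_cst|exact: ws].
- by move=> c c' p cp cp' V; rewrite (wt c c' p cp cp').
Qed.

(** Covers the degrees in which [hodge_covector] takes its default value. *)
Lemma homogeneous_form0 k : homogeneous_form ((fun c x V => 0) : tfield M k).
Proof.
split; last first.
  move=> c x cx V; rewrite mulr0 /lie big1 // addr0; exact: derive_cst.
split => //; split => //.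
- by move=> c x cx i a u v V; rewrite mulr0 addr0.
- by move=> c V r; exact: Ck_on_cst.
Qed.

Lemma homogeneous_form_ext_d k (w : tfield M k) :
  homogeneous_form w -> homogeneous_form (ext_d w).
Proof.
by move=> [wf wh]; split; [exact: is_form_ext_d|exact: homogeneous_ext_d].
Qed.

Variables (G : tfield M 2) (sgn : chart M -> 'rV[R]_m -> R).
Hypothesis Gt : is_tensor G.
Hypothesis Gu : forall c x, cod c x -> gram G c x \in unitmx.
Hypothesis sgn_near : forall c x, cod c x -> \forall y \near x, sgn c y = sgn c x.
Hypothesis sgn_trans : forall c c' p, dom c p -> dom c' p ->
  sgn c (coord c p) = sgn c' (coord c' p) *
    Num.sg (\det ('J (local_map idfun c c') (coord c p))).
Hypothesis XG : tfield_eq (lie X G) (fun c x V => 0).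

Lemma homogeneous_form_hodge k l (w : tfield M k) :
  homogeneous_form w -> homogeneous_form (hodge G sgn (l := l) w).
Proof.
move=> [wf wh]; have [kl|kl] := eqVneq (k + l)%N m.
  split; first exact: (is_form_hodge Gt Gu sgn_near sgn_trans kl (proj1 wf)).
  exact: (homogeneous_hodge Gt Gu sgn_near sgn_trans kl (proj1 wf) Xs XG wh).
(* When [k + l] differs from [m] the star is zero by definition; this case arises for instance from
   [ext_d] in top degree. *)
have -> : hodge G sgn (l := l) w = fun c x V => 0.
  apply/funext => c; apply/funext => x.
  by rewrite /hodge /hodge_covector (negPf kl).
exact: homogeneous_form0.
Qed.

Lemma homogeneous_form_codiff k (w : tfield M k) :
  homogeneous_form w -> homogeneous_form (codiff G sgn w).
Proof.
move=> wf; apply: homogeneous_formZ; apply: homogeneous_form_hodge.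
by apply: homogeneous_form_ext_d; exact: homogeneous_form_hodge.
Qed.

Lemma homogeneous_form_hodge_de_rham k (w : tfield M k) :
  homogeneous_form w -> homogeneous_form (hodge_de_rham G sgn w).
Proof.
case: k w => [|k] w wf /=.
  (* The degree is given explicitly so that the [k.-1] in the type of [codiff] reduces to the
     expected degree. *)
  by apply: (homogeneous_form_codiff (k := 1)); exact: homogeneous_form_ext_d.
apply: homogeneous_formD.
  by apply: homogeneous_form_ext_d; exact: (homogeneous_form_codiff wf).
by apply: (homogeneous_form_codiff (k := k.+2)); exact: homogeneous_form_ext_d.
Qed.

End HomogeneousForms.

Theorem proposition2p10 (R : realType) (n : nat) (B : principal_bundle R n)
    (o : chart (base B) -> base B -> R) (ho : is_orientation o)
    (g : tfield (total_space B) 2) (hg : is_carrollian g)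
    (theta : tfield (total_space B) 1) (htheta : is_connection_form theta)
    (hKilling : tfield_eq (lie (@euler R n B) g) (fun c x V => 0))
    (k : nat) (xi : tfield (total_space B) k) (hxi : is_form xi)
    (lambda : R) (hlambda : homogeneous (@euler R n B) lambda xi) :
  is_form (hodge_de_rham (lorentz_metric g theta) (total_sign o theta) xi) /\
  homogeneous (@euler R n B) lambda
    (hodge_de_rham (lorentz_metric g theta) (total_sign o theta) xi).
Proof.
have gt : is_tensor g by case: hg.
apply: homogeneous_form_hodge_de_rham.
- exact: euler_smooth.
- exact: is_tensor_lorentz.
- exact: gram_lorentz_unit.
- exact: total_sign_near.
- exact: total_sign_transition.
- exact: lie_lorentz.
- by split.
Qed.
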